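(* Let $w\ge 4$, $u=w-2$, $v=w-1$, let $\sum$ denote the sum over positive integers $a,b,c$ with $a+b+c=w$, and write $\tilde a=a-1$, $\tilde b=b-1$. Then, as identities of polynomials in $T$, \begin{align*} 2\sum 3^{\tilde a}2^{\tilde b}\zeta_\sqcup(a,b,c)&=\Big(\tfrac13\tbinom{v}{2}+u\Big)\zeta(w)+2\zeta_*(1,1,u)-2\zeta(u,2)+w\zeta_*(1,v),\\ 2\sum 3^{\tilde a}2^{\tilde b}\big(\zeta_\sqcup(a,\bar b,c)+\zeta(\bar a,b,\bar c)+\zeta(\bar a,\bar b,\bar c)\big)&=2\zeta(\bar1,1,u)+2\zeta_*(1,\bar1,u)+2\zeta(\bar1,\bar1,u)+\tbinom{v}{2}\zeta(w)+2\zeta(\bar1,v)\\ &\quad+2\zeta_*(1,\bar v)+2\zeta(\bar1,\bar v)-2\zeta(u,2)-4\zeta(u,\bar2)\\ &\quad+u\big(2\zeta(\bar1,v)+2\zeta(\bar w)+\zeta(w)+\zeta_*(1,v)\big),\\ 2\sum 3^{\tilde a}2^{\tilde b}\big(\zeta_\sqcup(a,\bar b,\bar c)+\zeta_\sqcup(a,b,\bar c)+\zeta(\bar a,\bar b,c)\big)&=2\zeta_*(1,1,\bar u)+2\zeta_*(1,\bar1,\bar u)+2\zeta(\bar1,1,\bar u)+2\zeta_*(1,\bar v)+2\zeta(\bar1,\bar v)\\ &\quad+2\zeta_*(1,v)+\zeta(\bar2,\bar u)-\zeta(2,\bar u)-4\zeta(\bar u,2)-2\zeta(\bar u,\bar2)\\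 &\quad+u\big(2\zeta_*(1,\bar v)+\zeta(\bar1,\bar v)+\zeta(w)+2\zeta(\bar w)\big)+\tbinom{v}{2}\zeta(\bar w)+\zeta(w)-\zeta(\bar w),\\ 2\sum 3^{\tilde a}2^{\tilde b}\zeta(\bar a,b,c)&=2\zeta(\bar1,\bar1,\bar u)+u\zeta(\bar1,\bar v)+2\zeta(\bar1,v)+\zeta(2,\bar u)-2\zeta(\bar u,\bar2)-\zeta(\bar2,\bar u)\\ &\quad+\Big(\tfrac13\tbinom{v}{2}+1\Big)\zeta(\bar w)+(w-3)\zeta(w). \end{align*}
   Context: Euler sums: for positive integers $s_j$ and $z_j\in\{\pm1\}$, $\zeta(s_1,\dots,s_d;z_1,\dots,z_d)=\sum_{n_1>\dots>n_d>0}\frac{z_1^{n_1}\cdots z_d^{n_d}}{n_1^{s_1}\cdots n_d^{s_d}}$, convergent iff $(s_1,z_1)\ne(1,1)$; a bar over the $j$-th argument means $z_j=-1$, no bar means $z_j=1$. Regularized values: the truncated sum $\zeta^{(M)}$ (restricted to $M\ge n_1$) has, as $M\to\infty$, an expansion $P(\log M+\gamma)+o(1)$ with $P$ a polynomial ($\gamma$ Euler's constant); $\zeta_*:=P(T)\in\mathbb{R}[T]$. With $a_k=\prod_{j\le k}z_j$, $\int_0^{1-\varepsilon}\left(\frac{dt}{t}\right)^{s_1-1}\frac{dt}{a_1-t}\cdots\left(\frac{dt}{t}\right)^{s_d-1}\frac{dt}{a_d-t}$ (iterated integral over $1-\varepsilon>t_1>t_2>\dots>0$, forms read left to right) has, as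 $\varepsilon\to0^+$, an expansion $Q(-\log\varepsilon)+o(1)$; $\zeta_\sqcup:=Q(T)$. Both equal the Euler sum for convergent indices. *)

(* Defs.v *)
From Stdlib Require Import Reals ClassicalEpsilon.
From Coquelicot Require Import Coquelicot.
From HB Require Import structures.
From mathcomp Require Import all_boot all_algebra.
From mathcomp Require Import Rstruct.

Set Implicit Arguments.
Unset Strict Implicit.
Unset Printing Implicit Defensive.

Local Open Scope R_scope.

(* An index of an Euler sum: list of pairs (s_j, barred_j);
   barred_j = true means z_j = -1, false means z_j = 1. *)
Definition eindex := list (nat * bool).

Definition sgn (b : bool) : R := if b then -1 else 1.

Fixpoint trunc_zeta (l : eindex) (M : nat) : R :=
  match l with
  | nil => 1
  | (s, b) :: l' =>
      (fix go (m : nat) : R :=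
         match m with
         | O => 0
         | S m' => go m' + sgn b ^ m / INR m ^ s * trunc_zeta l' m'
         end) M
  end.

Definition zeta (l : eindex) : R := real (Lim_seq (trunc_zeta l)).

Definition euler_gamma : R :=
  real (Lim_seq (fun n => sum_f_R0 (fun k => / INR (S k)) n - ln (INR (S n)))).

Definition is_zeta_star (l : eindex) (P : {poly R}) : Prop :=
  is_lim_seq (fun M => trunc_zeta l M - P.[ln (INR M) + euler_gamma]%R) 0.

Definition zeta_star (l : eindex) : {poly R} :=
  epsilon (inhabits 0%R) (is_zeta_star l).

Inductive dform := Ft | Fa of R.

Definition dform_eval (f : dform) (t : R) : R :=
  match f with Ft => / t | Fa a => / (a - t) end.

Fixpoint iter_int (ws : list dform) (x : R) : R :=
  match ws with
  | nil => 1
  | w :: ws' => RInt (fun t => dform_eval w t * iter_int ws' t) 0 x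
  end.

Fixpoint word_aux (a : R) (l : eindex) : list dform :=
  match l with
  | nil => nil
  | (s, b) :: l' =>
      let a' := a * sgn b in nseq (s - 1)%N Ft ++ Fa a' :: word_aux a' l'
  end.

Definition eword (l : eindex) : list dform := word_aux 1 l.

Definition is_zeta_sh (l : eindex) (Q : {poly R}) : Prop :=
  filterlim (fun eps => iter_int (eword l) (1 - eps) - Q.[- ln eps]%R)
            (at_right 0) (locally 0).

Definition zeta_sh (l : eindex) : {poly R} :=
  epsilon (inhabits 0%R) (is_zeta_sh l).

Definition nb (n : nat) : nat * bool := (n, false).
Definition bb (n : nat) : nat * bool := (n, true).

Local Open Scope ring_scope.

Definition sum_abc (w : nat) (F : nat -> nat -> nat -> {poly R}) : {poly R} :=
  \sum_(a < w.+1) \sum_(b < w.+1) \sum_(c < w.+1 | [&& 0 < a, 0 < b, 0 < c & a + b + c == w]%N)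
     F a b c.

Definition zetaP (l : eindex) : {poly R} := (zeta l)%:P.

(* Main.v *)
(** An Euler sum of depth 3 is an iterated integral whose poles are three letters
    [a_1, a_2, a_3] in [{1, -1}].  The weights [3^(a-1) 2^(b-1)] are those for which the
    weighted sums, added over all orderings of three given letters, give
    [\sum_(a+b+c=w) Li_a Li_b Li_c]: both sides satisfy the same differential recursion in
    the weight.  So each left-hand side is, up to a factor, the sum of the products
    [zeta(a) zeta(b) zeta(c)] with prescribed signs.

    For truncated sums, partial fractions turn [\sum_(a+b+c=w) n^-a m^-b k^-c] into
    [n^-u / ((m-n)(k-n))], its two analogues, and terms supported on coinciding indices.
    Summing over [m, k <= M] leaves, for each [n], harmonic sums up to [M - n] and [n - 1];
    replacing [M - n] by [M] costs [O(log^3 M / M)], and the stuffle product then yields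
    the right-hand side.

    Both regularisations compare a function with a polynomial in a scale [L], namely the
    harmonic number for sums and [- ln (1 - x)] for integrals, up to an error smaller than
    every power of [1 / L].  Such expansions are unique and are stable under products,
    under summation against [z^n / n^s] and under integration against [dt / t] and
    [dt / (a - t)]. *)

Require Import Defs.
From Stdlib Require Import Reals ClassicalEpsilon.
From Coquelicot Require Import Coquelicot.
From HB Require Import structures.
From mathcomp Require Import all_boot all_order all_algebra.
From mathcomp Require Import ring lra zify polyrcf.
From mathcomp Require Import Rstruct.
Import Order.TTheory GRing.Theory Num.Theory.
Set Implicit Arguments.
Unset Strict Implicit.
Unset Printing Implicit Defensive.
Local Open Scope ring_scope.
(* Without this, terms with expected type [R] would be parsed in [R_scope]. *)
Bind Scope ring_scope with R.
Local Arguments trunc_zeta : simpl never.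
Local Arguments exp x%_ring_scope.
Local Arguments ln x%_ring_scope.

(** * Sums over compositions and partial fractions *)

(** The left-hand sides use the integral regularisation and the right-hand sides the sum
    regularisation, and in depth 3 the two can differ. They meet only in products of depth-one
    values, where both give T for zeta(1) and the ordinary value otherwise, so no comparison map
    between regularisations is needed.

    The error class is dictated by the divergent letter. A sum of r(n)/n, or an integral of r(x)/(1
    - x), need not converge when r is merely o(1). An error below every power of 1/L survives: the
    sum of L^-(k+2)/n beyond N is of order L(N)^-(k+1).

    The four identities belong to the letter multisets {1,1,1}, {1,-1,-1}, {1,1,-1} and {-1,-1,-1}.
    Repeated letters make the six orderings coincide in groups, which is the origin of the factors 2
    and 1/3. *)

Section Compositions.
Variable V : nmodType.

Definition comp2 (w : nat) (F : nat -> nat -> V) : V :=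
  \sum_(1 <= a < w) F a (w - a)%N.

Definition comp3 (w : nat) (F : nat -> nat -> nat -> V) : V :=
  \sum_(1 <= a < w) comp2 (w - a) (F a).

Lemma comp2_le1 w F : (w <= 1)%N -> comp2 w F = 0.
Proof. by move=> h; rewrite /comp2 big_geq. Qed.

Lemma comp2S w F :
  comp2 w.+2 F = F 1 w.+1 + comp2 w.+1 (fun a b => F a.+1 b).
Proof. by rewrite /comp2 big_ltn // big_add1 /= subn1. Qed.

Lemma comp3_2 F : comp3 2 F = 0.
Proof. by rewrite /comp3 big_nat1 comp2_le1. Qed.

(** Splitting off first part 1 and lowering the other first parts is the recursion in the weight on
    which both the partial fractions and the differential equations rest. *)
Lemma comp3S w F :
  comp3 w.+2 F = comp2 w.+1 (F 1) + comp3 w.+1 (fun a => F a.+1).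
Proof. by rewrite /comp3 big_ltn // big_add1 /= subn1. Qed.

Lemma eq_comp2 w F G :
  (forall a b, (0 < a)%N -> (0 < b)%N -> (a + b = w)%N -> F a b = G a b) ->
  comp2 w F = comp2 w G.
Proof.
move=> h; apply: eq_big_nat => a /andP[a0 aw].
by apply: h; rewrite ?subn_gt0 // subnKC // ltnW.
Qed.

Lemma eq_comp3 w F G :
  (forall a b c, (0 < a)%N -> (0 < b)%N -> (0 < c)%N -> F a b c = G a b c) ->
  comp3 w F = comp3 w G.
Proof.
move=> h; apply: eq_big_nat => a /andP[a0 aw].
by apply: eq_comp2 => b c b0 c0 _; apply: h.
Qed.

Lemma comp2C w F : comp2 w F = comp2 w (fun a b => F b a).
Proof.
rewrite /comp2 big_nat_rev /=; apply: eq_big_nat => a /andP[a0 aw].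
by rewrite add1n subSS subKn // ltnW.
Qed.

Lemma comp2D w F G :
  comp2 w (fun a b => F a b + G a b) = comp2 w F + comp2 w G.
Proof. exact: big_split. Qed.

Lemma comp3D w F G :
  comp3 w (fun a b c => F a b c + G a b c) = comp3 w F + comp3 w G.
Proof. by rewrite /comp3 -big_split; apply: eq_bigr => a _; apply: comp2D. Qed.

End Compositions.

Lemma comp2_mull (A : pzSemiRingType) (x : A) w F :
  x * comp2 w F = comp2 w (fun a b => x * F a b).
Proof. by rewrite /comp2 mulr_sumr. Qed.

Lemma comp3_mull (A : pzSemiRingType) (x : A) w F :
  x * comp3 w F = comp3 w (fun a b c => x * F a b c).
Proof. by rewrite /comp3 mulr_sumr; apply: eq_bigr => a _; apply: comp2_mull. Qed.

Lemma comp3_sum (V : nmodType) w (I : Type) (r : seq I) (F : I -> nat -> nat -> nat -> V) :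
  comp3 w (fun a b c => \sum_(i <- r) F i a b c) = \sum_(i <- r) comp3 w (F i).
Proof.
rewrite /comp3 exchange_big; apply: eq_bigr => a _.
by rewrite /comp2 exchange_big.
Qed.

Lemma sum_abcE w F : sum_abc w F = comp3 w F.
Proof.
rewrite /sum_abc /comp3 -(big_mkord xpredT (fun a => \sum_(b < w.+1)
  \sum_(c < w.+1 | [&& 0 < a, 0 < b, 0 < c & a + b + c == w]%N) F a b c)).
rewrite big_ltn // big1 ?add0r; last by move=> b _; rewrite big_pred0.
have [w0|w0] := posnP w; first by subst w; rewrite !big_geq.
rewrite big_nat_recr //= [X in _ + X]big1 ?addr0; last first.
  move=> b _; apply: big1 => c /and4P[_ b0 c0 /eqP]; lia.
apply: eq_big_nat => a /andP[a0 aw].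
rewrite -(big_mkord xpredT (fun b =>
  \sum_(c < w.+1 | [&& 0 < a, 0 < b, 0 < c & a + b + c == w]%N) F a b c)).
rewrite big_ltn // big1 ?add0r; last by move=> b /and4P[].
rewrite (@big_cat_nat _ _ _ (w - a)%N) //=; last 2 first.
- lia.
- lia.
rewrite [X in _ + X]big_nat_cond [X in _ + X]big1 ?addr0; last first.
  by move=> b /andP[hb _]; apply: big1 => c /and4P[_ b0 c0 /eqP]; lia.
rewrite /comp2; apply: eq_big_nat => b /andP[b0 bw].
have cw : (w - a - b < w.+1)%N by lia.
rewrite (big_pred1 (Ordinal cw)) // => c /=.
rewrite -val_eqE /= a0 b0 /=; lia.
Qed.

Section PartialFractions.
Variable F : numFieldType.

(** The sum is geometric. If n = m the quotient is 0/0 = 0, and the last summand supplies the u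
    equal terms n^-(u+1). *)
Lemma comp2_partial_fractions (u : nat) (n m : F) : n != 0 -> m != 0 ->
  comp2 u.+1 (fun a b => n ^- a * m ^- b) =
  (n ^- u - m ^- u) / (m - n) + (n == m)%:R * u%:R * n ^- u.+1.
Proof.
move=> n0 m0; elim: u => [|u IH].
  by rewrite comp2_le1 // expr0 subrr mul0r mulr0 mul0r addr0.
rewrite comp2S (@eq_comp2 _ _ _ (fun a b => n^-1 * (n ^- a * m ^- b))); last first.
  by move=> a b *; rewrite exprS invfM mulrA.
rewrite -comp2_mull IH expr1 -[u.+1]addn1 natrD !addn1 !exprS.
have : n ^+ u != 0 by apply: expf_neq0.
have : m ^+ u != 0 by apply: expf_neq0.
have [<-|nm] := eqVneq n m.
  rewrite !subrr !mul0r !add0r /= !mul1r; move: (n ^+ u) => a _ a0.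
  by field; rewrite a0 n0.
have d0 : m - n != 0 by rewrite subr_eq0 eq_sym.
rewrite !mul0r !addr0; move: (n ^+ u) (m ^+ u) => a b b0 a0.
by field; rewrite d0 n0 m0 a0 b0.
Qed.

(* With the convention [0^-1 = 0] the degenerate cases need no separate formula:
   each of the three leading terms survives exactly when its index differs from
   both others. *)
Lemma comp3_partial_fractions (u : nat) (n m k : F) :
  n != 0 -> m != 0 -> k != 0 ->
  comp3 u.+2 (fun a b c => n ^- a * m ^- b * k ^- c) =
  n ^- u / (m - n) / (k - n) + m ^- u / (n - m) / (k - m)
  + k ^- u / (n - k) / (m - k)
  + (m == k)%:R * (u%:R * m ^- u.+1 / (n - m) - m ^- u / (n - m) ^+ 2)
  + (n == k)%:R * (u%:R * n ^- u.+1 / (m - n) - n ^- u / (m - n) ^+ 2)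
  + (n == m)%:R * (u%:R * n ^- u.+1 / (k - n) - n ^- u / (k - n) ^+ 2)
  + (n == m)%:R * (n == k)%:R * ('C(u.+1, 2)%:R * n ^- u.+2).
Proof.
move=> n0 m0 k0.
pose G u : F := n ^- u / (m - n) / (k - n) + m ^- u / (n - m) / (k - m)
  + k ^- u / (n - k) / (m - k)
  + (m == k)%:R * (u%:R * m ^- u.+1 / (n - m) - m ^- u / (n - m) ^+ 2)
  + (n == k)%:R * (u%:R * n ^- u.+1 / (m - n) - n ^- u / (m - n) ^+ 2)
  + (n == m)%:R * (u%:R * n ^- u.+1 / (k - n) - n ^- u / (k - n) ^+ 2)
  + (n == m)%:R * (n == k)%:R * ('C(u.+1, 2)%:R * n ^- u.+2).
have simp := (subrr, invr0, expr0n, mulr0, mul0r, addr0, add0r, subr0, oppr0, mul1r, mulr1n,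
  mulr0n).
(* The closed form [G] is checked against [comp3S]: first part 1 leaves n^-1 times the two-variable
   sum, and a larger first part releases a factor n^-1. The rest is rational algebra for each
   coincidence pattern of n, m, k. *)
suff : G 0 = 0 /\ forall u, G u.+1 =
  n^-1 * ((m ^- u.+1 - k ^- u.+1) / (k - m) + (m == k)%:R * u.+1%:R * m ^- u.+2) + n^-1 * G u.
  move=> [G0 GS]; elim: u => [|u IH]; first by rewrite comp3_2 -[RHS]/(G 0) G0.
  rewrite comp3S -[RHS]/(G u.+1) GS -[G u]IH -comp2_partial_fractions //.
  congr (_ + _); first by rewrite comp2_mull; apply: eq_comp2 => b c *; rewrite expr1 mulrA.
  by rewrite comp3_mull; apply: eq_comp3 => a b c *; rewrite exprS invfM !mulrA.
have binE i : 'C(i.+2, 2)%:R = 'C(i.+1, 2)%:R + i.+1%:R :> F by rewrite binS bin1 natrD.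
rewrite {}/G; have [e|nm] := eqVneq n m; have [e'|nk] := eqVneq n k.
- subst m k; rewrite !eqxx !simp; split=> // i.
  rewrite !simp binE -[i.+1]addn1 natrD !addn1 !exprS.
  have : n ^+ i != 0 by apply: expf_neq0.
  move: (n ^+ i) ('C(_, _)%:R : F) => a C a0.
  by field; rewrite a0 n0.
- subst m; rewrite (negbTE nk) !simp.
  have d0 : k - n != 0 by rewrite subr_eq0 eq_sym.
  have d1 : n - k != 0 by rewrite subr_eq0.
  split=> [|i]; first by rewrite !expr0; field; rewrite d0 d1.
  rewrite !simp -[i.+1]addn1 natrD !addn1 !exprS.
  have : n ^+ i != 0 by apply: expf_neq0.
  have : k ^+ i != 0 by apply: expf_neq0.
  move: (n ^+ i) (k ^+ i) => a b a0 b0.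
  by field; rewrite a0 b0 d0 d1 n0 k0.
- subst k; rewrite eq_sym (negbTE nm) !simp.
  have d0 : m - n != 0 by rewrite subr_eq0 eq_sym.
  have d1 : n - m != 0 by rewrite subr_eq0.
  split=> [|i]; first by rewrite !expr0; field; rewrite d0 d1.
  rewrite !simp -[i.+1]addn1 natrD !addn1 !exprS.
  have : n ^+ i != 0 by apply: expf_neq0.
  have : m ^+ i != 0 by apply: expf_neq0.
  move: (n ^+ i) (m ^+ i) => a b a0 b0.
  by field; rewrite a0 b0 d0 d1 n0 m0.
have d0 : m - n != 0 by rewrite subr_eq0 eq_sym.
have d1 : n - m != 0 by rewrite subr_eq0.
have d2 : k - n != 0 by rewrite subr_eq0 eq_sym.
have d3 : n - k != 0 by rewrite subr_eq0.
have [e|mk] := eqVneq m k.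
  subst k; rewrite !simp; split=> [|i]; first by rewrite !expr0; field; rewrite d0 d1.
  rewrite !simp -[i.+1]addn1 natrD !addn1 !exprS.
  have : n ^+ i != 0 by apply: expf_neq0.
  have : m ^+ i != 0 by apply: expf_neq0.
  move: (n ^+ i) (m ^+ i) => a b a0 b0.
  by field; rewrite a0 b0 d0 d1 n0 m0.
have d4 : m - k != 0 by rewrite subr_eq0.
have d5 : k - m != 0 by rewrite subr_eq0 eq_sym.
rewrite !simp; split=> [|i]; first by rewrite !expr0; field; rewrite d0 d1 d2 d3 d4 d5.
rewrite !simp !exprS.
have : n ^+ i != 0 by apply: expf_neq0.
have : m ^+ i != 0 by apply: expf_neq0.
have : k ^+ i != 0 by apply: expf_neq0.
move: (n ^+ i) (m ^+ i) (k ^+ i) => a b c a0 b0 c0.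
by field; rewrite a0 b0 c0 d0 d1 d2 d3 d4 d5 n0 m0 k0.
Qed.

End PartialFractions.

(** * Truncated Euler sums *)

Lemma sgnE b : sgn b = (-1) ^+ b :> R.
Proof.
by case: b => //; rewrite /sgn; change (-1)%R with (Ropp 1%R); rewrite expr1.
Qed.

Lemma sgn_addb b c : sgn (b (+) c) = sgn b * sgn c.
Proof. by rewrite !sgnE signr_addb. Qed.

Lemma sgn_sqr b : sgn b * sgn b = 1.
Proof. by rewrite -sgn_addb addbb. Qed.

Lemma normr_sgnX b n : `|sgn b ^+ n| = 1.
Proof. by rewrite normrX sgnE normr_sign expr1n. Qed.

Definition term (s : nat) (b : bool) (n : nat) : R := sgn b ^+ n / n%:R ^+ s.

Lemma term_addb s t b c n : term (s + t) (b (+) c) n = term s b n * term t c n.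
Proof. by rewrite /term sgn_addb exprMn exprD invfM mulrACA. Qed.

Lemma trunc_zetaS s b l M :
  trunc_zeta ((s, b) :: l) M.+1 =
  trunc_zeta ((s, b) :: l) M + term s b M.+1 * trunc_zeta l M.
Proof. by rewrite /term -INRE -!RpowE. Qed.

Lemma trunc_zeta_sum s b l M :
  trunc_zeta ((s, b) :: l) M =
  \sum_(1 <= n < M.+1) term s b n * trunc_zeta l n.-1.
Proof.
elim: M => [|M IH]; first by rewrite big_geq.
by rewrite trunc_zetaS IH [RHS]big_nat_recr.
Qed.

Notation trunc1 s b := (trunc_zeta [:: (s%N, b)]).

Lemma trunc1S s b M : trunc1 s b M.+1 = trunc1 s b M + term s b M.+1.
Proof. by rewrite trunc_zetaS mulr1. Qed.

Lemma trunc1_sum s b M : trunc1 s b M = \sum_(1 <= n < M.+1) term s b n.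
Proof. by rewrite trunc_zeta_sum; apply: eq_bigr => n _; rewrite mulr1. Qed.

Lemma stuffle2 s t b c M :
  trunc1 s b M * trunc1 t c M =
  trunc_zeta [:: (s, b); (t, c)] M + trunc_zeta [:: (t, c); (s, b)] M
  + trunc1 (s + t)%N (b (+) c) M.
Proof.
elim: M => [|M IH]; first by rewrite mulr0 !addr0.
by rewrite !trunc1S !trunc_zetaS term_addb mulrDl !mulrDr IH; ring.
Qed.

(* The inner differences are the partial sums over [n <= j <= M], so the left-hand
   side is the sum over [j, i >= n]. *)
Lemma stuffle3 u b c d M :
  \sum_(1 <= n < M.+1) term u d n * (trunc1 1 b M - trunc1 1 b n.-1)
                                  * (trunc1 1 c M - trunc1 1 c n.-1) =
  trunc_zeta [:: (1%N, b); (1%N, c); (u, d)] M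
  + trunc_zeta [:: (1%N, c); (1%N, b); (u, d)] M
  + trunc_zeta [:: (2%N, b (+) c); (u, d)] M
  + trunc_zeta [:: (1%N, b); (u.+1, c (+) d)] M
  + trunc_zeta [:: (1%N, c); (u.+1, b (+) d)] M
  + trunc1 u.+2 (b (+) c (+) d) M.
Proof.
(* The one-factor analogue, to which the cross terms of the increment at M+1 reduce. *)
have tail e N : \sum_(1 <= n < N.+1) term u d n * (trunc1 1 e N - trunc1 1 e n.-1) =
    trunc_zeta [:: (1%N, e); (u, d)] N + trunc1 u.+1 (e (+) d) N.
  under eq_bigr do rewrite mulrBr.
  rewrite sumrB -mulr_suml -trunc1_sum -trunc_zeta_sum mulrC stuffle2 add1n.
  by ring.
elim: M => [|M IH]; first by rewrite big_geq // !addr0.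
rewrite big_nat_recr //= !trunc1S !trunc_zetaS.
have ->: \sum_(1 <= n < M.+1) term u d n
           * (trunc1 1 b M + term 1 b M.+1 - trunc1 1 b n.-1)
           * (trunc1 1 c M + term 1 c M.+1 - trunc1 1 c n.-1) =
  \sum_(1 <= n < M.+1) (term u d n * (trunc1 1 b M - trunc1 1 b n.-1)
                                   * (trunc1 1 c M - trunc1 1 c n.-1)
    + term 1 c M.+1 * (term u d n * (trunc1 1 b M - trunc1 1 b n.-1))
    + term 1 b M.+1 * (term u d n * (trunc1 1 c M - trunc1 1 c n.-1))
    + term 1 b M.+1 * term 1 c M.+1 * term u d n).
  by apply: eq_bigr => n _; ring.
rewrite !big_split /= IH -!mulr_sumr !tail -trunc1_sum.
have -> : term u.+2 (b (+) c (+) d) M.+1 = term 1 b M.+1 * term 1 c M.+1 * term u d M.+1.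
  by rewrite -[u.+2]/(1 + 1 + u)%N !term_addb.
have -> : term 2 (b (+) c) M.+1 = term 1 b M.+1 * term 1 c M.+1.
  by rewrite -[2%N]/(1 + 1)%N term_addb.
by ring.
Qed.

Section DifferenceSums.
Variables (b : bool) (M n : nat).
Hypothesis nM : (0 < n <= M)%N.

(** The singular index m = n contributes 0 because 0^-1 = 0; the others are n + j or n - j. *)
Let split_sum (f : nat -> R) : f n = 0 ->
  \sum_(1 <= m < M.+1) f m =
  \sum_(1 <= j < (M - n).+1) f (n + j)%N + \sum_(1 <= j < n.-1.+1) f (n - j)%N.
Proof.
move=> fn0; case/andP: nM => n0 nM'.
rewrite (@big_cat_nat _ _ _ n) //=; last by rewrite leqW.
rewrite [X in _ + X]big_ltn ?ltnS // fn0 add0r addrC prednK //; congr (_ + _).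
  rewrite -{1}[n.+1]add1n big_addn subSn //.
  by apply: eq_bigr => j _; rewrite addnC.
by rewrite big_nat_rev /=; apply: eq_bigr => j _; rewrite add1n subSS.
Qed.

(** Below n the denominator is -j, hence the minus sign; since signs square to 1, the sign at n - j
    factors like the one at n + j. With squared denominators both halves enter positively. *)
Lemma sum_inv_diff :
  \sum_(1 <= m < M.+1) sgn b ^+ m / (m%:R - n%:R) =
  sgn b ^+ n * (trunc1 1 b (M - n) - trunc1 1 b n.-1).
Proof.
rewrite split_sum ?subrr ?invr0 ?mulr0 // mulrBr !trunc1_sum !mulr_sumr -sumrN.
congr (_ + _); apply: eq_big_nat => j /andP[j0 jn]; rewrite /term expr1 mulrA.
  by rewrite exprD natrD [n%:R + _]addrC addrK.
have jn' : (j <= n)%N by lia.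
rewrite natrB // addrAC subrr add0r invrN mulrN; congr (- (_ / _)).
by rewrite -{2}(subnK jn') exprD -mulrA -exprMn sgn_sqr expr1n mulr1.
Qed.

Lemma sum_inv_diff_sqr :
  \sum_(1 <= m < M.+1) sgn b ^+ m / (m%:R - n%:R) ^+ 2 =
  sgn b ^+ n * (trunc1 2 b (M - n) + trunc1 2 b n.-1).
Proof.
rewrite split_sum ?subrr ?expr0n ?invr0 ?mulr0 // mulrDr !trunc1_sum !mulr_sumr.
congr (_ + _); apply: eq_big_nat => j /andP[j0 jn]; rewrite /term mulrA.
  by rewrite exprD natrD [n%:R + _]addrC addrK.
have jn' : (j <= n)%N by lia.
rewrite natrB // addrAC subrr add0r sqrrN; congr (_ / _).
by rewrite -{2}(subnK jn') exprD -mulrA -exprMn sgn_sqr expr1n mulr1.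
Qed.

End DifferenceSums.

(** [tail1] and [join2] are the brackets of [sum_inv_diff] and [sum_inv_diff_sqr], with K standing
    for M - n. *)
Definition tail1 (e : bool) (K n : nat) : R := trunc1 1 e K - trunc1 1 e n.-1.
Definition join2 (e : bool) (K n : nat) : R := trunc1 2 e K + trunc1 2 e n.-1.

(* [K n] is [M - n] in the exact formula and [M] in its asymptotic form. *)
Definition triple_sum (u : nat) (b c d : bool) (K : nat -> nat) (M : nat) : R :=
  \sum_(1 <= n < M.+1)
    (term u (b (+) c (+) d) n
       * (tail1 c (K n) n * tail1 d (K n) n + tail1 b (K n) n * tail1 d (K n) n
          + tail1 b (K n) n * tail1 c (K n) n)
     + u%:R * term u.+1 (b (+) c (+) d) n
       * (tail1 b (K n) n + tail1 c (K n) n + tail1 d (K n) n)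
     - term u (b (+) c (+) d) n
       * (join2 b (K n) n + join2 c (K n) n + join2 d (K n) n)
     + 'C(u.+1, 2)%:R * term u.+2 (b (+) c (+) d) n).

(** In each leading partial fraction one index is subtracted from both others; with that index
    outermost the two inner sums are independent and factor. When two indices coincide, both signs
    are attached to the common index and the third is summed freely. *)
Lemma triple_product u b c d M :
  comp3 u.+2 (fun s t r => trunc1 s b M * trunc1 t c M * trunc1 r d M) =
  triple_sum u b c d (fun n => M - n)%N M.
Proof.
pose h (n m k : nat) : R := comp3 u.+2 (fun s t r => n%:R ^- s * m%:R ^- t * k%:R ^- r).
have -> : comp3 u.+2 (fun s t r => trunc1 s b M * trunc1 t c M * trunc1 r d M) =
  \sum_(1 <= n < M.+1) \sum_(1 <= m < M.+1) \sum_(1 <= k < M.+1)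
    sgn b ^+ n * sgn c ^+ m * sgn d ^+ k * h n m k.
  under eq_bigr => n _ do under eq_bigr => m _ do under eq_bigr => k _ do
    rewrite /h comp3_mull.
  under eq_bigr => n _ do under eq_bigr => m _ do rewrite -comp3_sum.
  under eq_bigr => n _ do rewrite -comp3_sum.
  rewrite -comp3_sum; apply: eq_comp3 => s t r _ _ _.
  rewrite !trunc1_sum -mulrA mulr_suml; apply: eq_bigr => n _.
  rewrite big_distrlr /= mulr_sumr; apply: eq_bigr => m _; rewrite mulr_sumr.
  by apply: eq_bigr => k _; rewrite /term; ring.
pose i (n m : nat) : R := (m%:R - n%:R)^-1.
pose f e (n m : nat) : R := sgn e ^+ m * i n m.
pose g e (n m : nat) : R := sgn e ^+ m * i n m ^+ 2.
pose t e n : R := sgn e ^+ n * n%:R ^- u.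
pose t1 e e' n : R := u%:R * (sgn e ^+ n * sgn e' ^+ n * n%:R ^- u.+1).
pose t0 e e' n : R := sgn e ^+ n * sgn e' ^+ n * n%:R ^- u.
have hE n m k : (0 < n)%N -> (0 < m)%N -> (0 < k)%N ->
  sgn b ^+ n * sgn c ^+ m * sgn d ^+ k * h n m k =
  t b n * (f c n m * f d n k) + t c m * (f b m n * f d m k)
  + t d k * (f b k n * f c k m)
  + (m == k)%:R * (t1 c d m * f b m n - t0 c d m * g b m n)
  + (n == k)%:R * (t1 b d n * f c n m - t0 b d n * g c n m)
  + (n == m)%:R * (t1 b c n * f d n k - t0 b c n * g d n k)
  + (n == m)%:R * ((n == k)%:R * ('C(u.+1, 2)%:R * term u.+2 (b (+) c (+) d) n)).
  move=> n0 m0 k0; rewrite /h comp3_partial_fractions ?pnatr_eq0 -?lt0n //.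
  rewrite !eqr_nat /t /t1 /t0 /f /g /term !sgn_addb !exprMn -!exprVn -/(i n m) -/(i n k) -/(i m n)
    -/(i m k) -/(i k n) -/(i k m).
  have [e|nm] := eqVneq n m; have [e'|nk] := eqVneq n k; last first.
  - have [e|mk] := eqVneq m k; first by subst k; rewrite /=; ring.
    by rewrite /=; ring.
  - by subst k; rewrite eq_sym (negbTE nm) /=; ring.
  - by subst m; rewrite (negbTE nk) /=; ring.
  - by subst m k; rewrite eqxx /=; ring.
have -> : \sum_(1 <= n < M.+1) \sum_(1 <= m < M.+1) \sum_(1 <= k < M.+1)
    sgn b ^+ n * sgn c ^+ m * sgn d ^+ k * h n m k =
  \sum_(1 <= n < M.+1) \sum_(1 <= m < M.+1) \sum_(1 <= k < M.+1)
   (t b n * (f c n m * f d n k) + t c m * (f b m n * f d m k)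
  + t d k * (f b k n * f c k m)
  + (m == k)%:R * (t1 c d m * f b m n - t0 c d m * g b m n)
  + (n == k)%:R * (t1 b d n * f c n m - t0 b d n * g c n m)
  + (n == m)%:R * (t1 b c n * f d n k - t0 b c n * g d n k)
  + (n == m)%:R * ((n == k)%:R * ('C(u.+1, 2)%:R * term u.+2 (b (+) c (+) d) n))).
  apply: eq_big_nat => n /andP[n0 _]; apply: eq_big_nat => m /andP[m0 _].
  by apply: eq_big_nat => k /andP[k0 _]; apply: hE.
have delta (n : nat) (F : nat -> R) : (0 < n <= M)%N ->
    \sum_(1 <= k < M.+1) (n == k)%:R * F k = F n.
  move=> hn; rewrite (big_cat_nat (n := n)) //=; [|lia..].
  rewrite big_nat_cond big1 ?add0r; last first.
    by move=> k /andP[hk _]; rewrite (_ : n == k = false) ?mul0r //; lia.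
  rewrite big_ltn ?eqxx ?mul1r; last by lia.
  rewrite big_nat_cond big1 ?addr0 // => k /andP[hk _].
  by rewrite (_ : n == k = false) ?mul0r //; lia.
have sum3 (F : nat -> R) (G G' : nat -> nat -> R) :
    \sum_(1 <= n < M.+1) \sum_(1 <= m < M.+1) \sum_(1 <= k < M.+1) F n * (G n m * G' n k) =
    \sum_(1 <= n < M.+1) F n * ((\sum_(1 <= m < M.+1) G n m) * (\sum_(1 <= m < M.+1) G' n m)).
  apply: eq_bigr => n _; rewrite big_distrlr /= mulr_sumr; apply: eq_bigr => m _.
  by rewrite mulr_sumr.
have sumD (F G : nat -> R) (f' g' : nat -> nat -> R) n :
    \sum_(1 <= m < M.+1) (F n * f' n m - G n * g' n m) =
    F n * (\sum_(1 <= m < M.+1) f' n m) - G n * (\sum_(1 <= m < M.+1) g' n m).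
  by rewrite sumrB !mulr_sumr.
under eq_bigr => n _ do under eq_bigr => m _ do rewrite !big_split /=.
under eq_bigr => n _ do rewrite !big_split /=.
rewrite !big_split /= sum3.
(* The exchanges bring the index that carries the power outermost, where it is renamed n. *)
rewrite [X in _ + X + _ + _ + _ + _ + _]exchange_big /= sum3.
under [X in _ + _ + X + _ + _ + _ + _]eq_bigr => n _ do rewrite exchange_big /=.
rewrite [X in _ + _ + X + _ + _ + _ + _]exchange_big /= sum3.
rewrite [X in _ + _ + _ + X + _ + _ + _]exchange_big /=.
rewrite /triple_sum -!big_split /=; apply: eq_big_nat => n hn.
have hn' : (0 < n <= M)%N by lia.
have fE e : \sum_(1 <= m < M.+1) f e n m = sgn e ^+ n * tail1 e (M - n) n.
  exact: sum_inv_diff.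
have gE e : \sum_(1 <= m < M.+1) g e n m = sgn e ^+ n * join2 e (M - n) n.
  by rewrite -sum_inv_diff_sqr //; apply: eq_bigr => m _; rewrite /g /i exprVn.
rewrite !fE.
have -> : \sum_(1 <= m < M.+1) \sum_(1 <= k < M.+1)
    (n == k)%:R * (t1 c d n * f b n m - t0 c d n * g b n m) =
    t1 c d n * (sgn b ^+ n * tail1 b (M - n) n)
    - t0 c d n * (sgn b ^+ n * join2 b (M - n) n).
  by rewrite -fE -gE -sumD; apply: eq_bigr => m _; rewrite delta.
have -> : \sum_(1 <= m < M.+1) \sum_(1 <= k < M.+1)
    (n == k)%:R * (t1 b d n * f c n m - t0 b d n * g c n m) =
    t1 b d n * (sgn c ^+ n * tail1 c (M - n) n)
    - t0 b d n * (sgn c ^+ n * join2 c (M - n) n).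
  by rewrite -fE -gE -sumD; apply: eq_bigr => m _; rewrite delta.
under eq_bigr => m _ do rewrite -mulr_sumr sumD fE gE.
rewrite delta //.
under [X in _ + X = _]eq_bigr => m _ do rewrite -mulr_sumr delta //.
rewrite delta // /t /t1 /t0 /term !sgn_addb !exprMn; ring.
Qed.

(** * Polynomial expansions in a scale *)

Lemma is_lim_seqE (u : nat -> R) (l : R) :
  is_lim_seq u l <->
  (forall e, 0 < e -> exists N, forall n, (N <= n)%N -> `|u n - l| < e).
Proof.
rewrite -is_lim_seq_spec; split=> [h e /RltP e0|h [e e0]].
  have [N hN] := h (mkposreal e e0); exists N => n /ssrnat.leP /hN /RltP.
  by rewrite RabsE.
have [|N hN] := h e; first exact/RltP.
by exists N => n /ssrnat.leP /hN nN; apply/RltP; rewrite RabsE.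
Qed.

Lemma cauchy_is_lim_seq (u : nat -> R) :
  (forall e, 0 < e -> exists N, forall n m, (N <= n)%N -> (N <= m)%N -> `|u n - u m| < e) ->
  exists l : R, is_lim_seq u l.
Proof.
move=> h; apply/ex_lim_seq_cauchy_corr => -[e e0].
have [|N hN] := h e; first exact/RltP.
by exists N => n m /ssrnat.leP nN /ssrnat.leP mN; apply/RltP; rewrite RabsE hN.
Qed.

(** From 1 + x <= k (1 + x/k) <= k exp(x/k), raised to the k-th power; hence the constant k^k. With
    x = L it makes exp(-L) a rapid error, which is of order 1/n for sums and equals 1 - x for
    integrals. *)
Lemma exp_ge_power (k : nat) : exists2 C : R, 0 < C &
  forall x : R, 0 <= x -> (1 + x) ^+ k <= C * exp x.
Proof.
case: k => [|k].
  exists 1 => // x x0; rewrite expr0 mul1r.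
  by apply: le_trans (_ : 1 + x <= _); [lra|apply/RleP/exp_ineq1_le].
exists (k.+1%:R ^+ k.+1) => [|x x0]; first by rewrite exprn_gt0 // ltr0n.
have k0 : 0 < k.+1%:R :> R by rewrite ltr0n.
pose y : R := x / k.+1%:R.
have yK : k.+1%:R * y = x by rewrite mulrC divfK ?gt_eqF.
have -> : exp x = exp y ^+ k.+1 by rewrite expRX -mulr_natl yK.
rewrite -exprMn; apply: lerXn2r; rewrite ?nnegrE.
- lra.
- by rewrite mulr_ge0 //; apply/RleP/Rlt_le/exp_pos.
have /RleP/(ler_wpM2l (ltW k0)) := exp_ineq1_le y.
rewrite RplusE mulrDr mulr1 yK; apply: le_trans.
by rewrite lerD2r ler1n.
Qed.

Section Asymptotics.
Variables (T : Type) (D : T -> Prop) (L : T -> R).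
Hypothesis L_ge0 : forall x, D x -> 0 <= L x.

(** The bound is imposed on all of D, so that errors combine without thresholds, and uses 1 + L
    because L may vanish. *)
Definition rapid (r : T -> R) : Prop :=
  forall k, exists C : R, forall x, D x -> `|r x| * (1 + L x) ^+ k <= C.

Definition slow (f : T -> R) : Prop :=
  exists k, exists C : R, forall x, D x -> `|f x| <= C * (1 + L x) ^+ k.

(** The o(1) in the definitions of the regularised values; [rapid] is the stronger class in which
    expansions are propagated. *)
Definition vanishing (r : T -> R) : Prop :=
  forall e : R, 0 < e -> exists B : R, forall x, D x -> B <= L x -> `|r x| < e.

Definition asym (f : T -> R) (P : {poly R}) : Prop :=
  rapid (fun x => f x - P.[L x]).

Let L1_ge1 x : D x -> 1 <= 1 + L x.
Proof. by move/L_ge0; lra. Qed.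

Let L1X_gt0 k x : D x -> 0 < (1 + L x) ^+ k.
Proof. by move/L1_ge1 => h; apply: exprn_gt0; lra. Qed.

Lemma eq_rapid r s : (forall x, D x -> r x = s x) -> rapid r -> rapid s.
Proof. by move=> e h k; have [C hC] := h k; exists C => x Dx; rewrite -e // hC. Qed.

Lemma rapidD r s : rapid r -> rapid s -> rapid (fun x => r x + s x).
Proof.
move=> hr hs k; have [C hC] := hr k; have [C' hC'] := hs k.
exists (C + C') => x Dx; apply: le_trans (lerD (hC x Dx) (hC' x Dx)).
by rewrite -mulrDl ler_wpM2r ?ler_normD // ltW // L1X_gt0.
Qed.

Lemma rapidM f r : slow f -> rapid r -> rapid (fun x => f x * r x).
Proof.
move=> [k [C hC]] hr j; have [C' hC'] := hr (k + j)%N.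
exists (C * C') => x Dx; have [h h'] := (hC x Dx, hC' x Dx).
have C0 : 0 <= C.
  by rewrite -(pmulr_lge0 _ (L1X_gt0 k Dx)); apply: le_trans h.
apply: le_trans (ler_wpM2l C0 h').
rewrite normrM exprD mulrCA !mulrA ler_wpM2r ?(ltW (L1X_gt0 j Dx)) //.
rewrite mulrC -!mulrA; apply: le_trans (ler_wpM2l (normr_ge0 _) h) _.
by rewrite !mulrA; lra.
Qed.

Lemma slow_rapid r : rapid r -> slow r.
Proof.
move=> h; have [C hC] := h 0; exists 0, C => x Dx.
by have := hC x Dx; rewrite expr0 !mulr1.
Qed.

Lemma slowD f g : slow f -> slow g -> slow (fun x => f x + g x).
Proof.
move=> [k [C hC]] [j [C' hC']]; exists (k + j)%N, (C + C') => x Dx.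
apply: le_trans (ler_normD _ _) _; rewrite mulrDl; apply: lerD.
  apply: le_trans (hC x Dx) _; rewrite exprD mulrA ler_peMr //.
    exact: le_trans (normr_ge0 _) (hC x Dx).
  exact/exprn_ege1/L1_ge1.
apply: le_trans (hC' x Dx) _; rewrite exprD mulrCA ler_peMl //.
  exact: le_trans (normr_ge0 _) (hC' x Dx).
exact/exprn_ege1/L1_ge1.
Qed.

Lemma slowM f g : slow f -> slow g -> slow (fun x => f x * g x).
Proof.
move=> [k [C hC]] [j [C' hC']]; exists (k + j)%N, (C * C') => x Dx.
by rewrite normrM exprD mulrACA ler_pM ?hC ?hC'.
Qed.

Lemma slow_cst (c : R) : slow (fun=> c).
Proof. by exists 0, `|c| => x _; rewrite expr0 mulr1. Qed.

Lemma slow_L : slow L.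
Proof.
exists 1, 1 => x Dx; rewrite expr1 mul1r ger0_norm ?L_ge0 //; lra.
Qed.

Lemma slow_horner (P : {poly R}) : slow (fun x => P.[L x]).
Proof.
elim/poly_ind: P => [|P c IH].
  by have [k [C h]] := slow_cst 0; exists k, C => x Dx; rewrite horner0 h.
have [k [C h]] := slowD (slowM IH slow_L) (slow_cst c).
by exists k, C => x Dx; rewrite hornerMXaddC h.
Qed.

Lemma eq_asym f g P : (forall x, D x -> f x = g x) -> asym f P -> asym g P.
Proof. by move=> e; apply: eq_rapid => x Dx; rewrite e. Qed.

Lemma asym_slow f P : asym f P -> slow f.
Proof.
move=> h; have [k [C hC]] := slowD (slow_rapid h) (slow_horner P).
by exists k, C => x Dx; have := hC x Dx; rewrite subrK.
Qed.

Lemma rapid_asym0 r : rapid r -> asym r 0.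
Proof. by apply: eq_rapid => x _; rewrite horner0 subr0. Qed.

Lemma asym0_rapid r : asym r 0 -> rapid r.
Proof. by apply: eq_rapid => x _; rewrite horner0 subr0. Qed.

Lemma asym_horner P : asym (fun x => P.[L x]) P.
Proof. by move=> k; exists 0 => x _; rewrite subrr normr0 mul0r. Qed.

Lemma asymC (c : R) : asym (fun=> c) c%:P.
Proof. by apply: eq_asym (asym_horner _) => x _; rewrite hornerC. Qed.

Lemma asymD f g P Q : asym f P -> asym g Q -> asym (fun x => f x + g x) (P + Q).
Proof.
by move=> hf hg; apply: eq_rapid (rapidD hf hg) => x _; rewrite hornerD; ring.
Qed.

Lemma asymM f g P Q : asym f P -> asym g Q -> asym (fun x => f x * g x) (P * Q).
Proof.
move=> hf hg.
apply: eq_rapid (rapidD (rapidM (asym_slow hf) hg) (rapidM (slow_horner Q) hf)) => x _.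
by rewrite hornerM; ring.
Qed.

Lemma asymZ c f P : asym f P -> asym (fun x => c * f x) (c *: P).
Proof. by rewrite -mul_polyC => /(asymM (asymC c)). Qed.

Lemma asymB f g P Q : asym f P -> asym g Q -> asym (fun x => f x - g x) (P - Q).
Proof.
move=> hf /(asymZ (-1)); rewrite scaleN1r => hg.
by apply: eq_asym (asymD hf hg) => x _; rewrite mulN1r.
Qed.

Lemma asym_sum (I : eqType) (r : seq I) (f : I -> T -> R) (P : I -> {poly R}) :
  (forall i, i \in r -> asym (f i) (P i)) ->
  asym (fun x => \sum_(i <- r) f i x) (\sum_(i <- r) P i).
Proof.
elim: r => [|i r IH] h.
  by rewrite big_nil; apply: eq_asym (asymC 0) => x _; rewrite big_nil.
rewrite big_cons; apply: eq_asym (asymD (h i (mem_head _ _)) (IH _)) => [x _|j jr].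
  by rewrite big_cons.
by apply: h; rewrite inE jr orbT.
Qed.

Lemma asym_comp3 w (f : nat -> nat -> nat -> T -> R) (P : nat -> nat -> nat -> {poly R}) :
  (forall a b c, (0 < a)%N -> (0 < b)%N -> (0 < c)%N -> asym (f a b c) (P a b c)) ->
  asym (fun x => comp3 w (fun a b c => f a b c x)) (comp3 w P).
Proof.
move=> h; apply: asym_sum => a; rewrite mem_index_iota => /andP[a0 aw].
apply: asym_sum => b; rewrite mem_index_iota => /andP[b0 bw].
by apply: h => //; rewrite subn_gt0.
Qed.

Lemma asym_comp f P Q : asym f P -> asym (fun x => Q.[f x]) (Q \Po P).
Proof.
move=> hf; elim/poly_ind: Q => [|Q c IH].
  by rewrite comp_poly0; apply: eq_asym (asymC 0) => x _; rewrite horner0.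
rewrite comp_poly_MXaddC; apply: eq_asym (asymD (asymM IH hf) (asymC c)) => x _.
by rewrite hornerMXaddC.
Qed.

Lemma rapid_vanishing r : rapid r -> vanishing r.
Proof.
move=> /(_ 1)[C hC] e e0; exists (`|C| / e) => x Dx hx.
have := hC x Dx; have := L1_ge1 Dx; rewrite expr1 => h1 h2.
have h3 : `|C| < (1 + L x) * e by rewrite -ltr_pdivrMr //; lra.
rewrite -(ltr_pM2r (lt_le_trans ltr01 h1)) [e * _]mulrC.
by apply: le_lt_trans h2 (le_lt_trans (ler_norm C) h3).
Qed.

Lemma vanishingD r s : vanishing r -> vanishing s -> vanishing (fun x => r x + s x).
Proof.
move=> hr hs e e0.
have e2 : 0 < e / 2 by rewrite divr_gt0.
have [B hB] := hr _ e2; have [B' hB'] := hs _ e2.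
exists (Num.max B B') => x Dx; rewrite ge_max => /andP[h h'].
apply: le_lt_trans (ler_normD _ _) _; have := hB x Dx h; have := hB' x Dx h'.
lra.
Qed.

Lemma vanishingN r : vanishing r -> vanishing (fun x => - r x).
Proof. by move=> h e /h[B hB]; exists B => x *; rewrite normrN hB. Qed.

Lemma eq_vanishing r s : (forall x, D x -> r x = s x) -> vanishing r -> vanishing s.
Proof. by move=> E h e /h[B hB]; exists B => x Dx *; rewrite -E // hB. Qed.

Section Unbounded.
Variable xs : nat -> T.
Hypothesis D_xs : forall n, D (xs n).
Hypothesis L_xs : forall B : R, exists N, forall n, (N <= n)%N -> B <= L (xs n).

Lemma vanishing_horner P : vanishing (fun x => P.[L x]) -> P = 0.
Proof.
wlog : P / 0 <= lead_coef P.
  move=> hw h; have [/hw|/ltW lP] := leP 0 (lead_coef P); first exact.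
  apply: oppr_inj; rewrite oppr0; apply: hw; first by rewrite lead_coefN oppr_ge0.
  by apply: eq_vanishing (vanishingN h) => x _; rewrite hornerN.
rewrite le_eqVlt => /orP[|lP h].
  by rewrite eq_sym lead_coef_eq0 => /eqP.
(* A polynomial with positive leading coefficient is eventually at least that coefficient, which is
   therefore a tolerance that cannot be met. *)
have [t ht] := poly_pinfty_gt_lc lP; have [B hB] := h _ lP.
have [N hN] := L_xs (Num.max t B).
have := hN N (leqnn N); rewrite ge_max => /andP[/ht h1 /(hB _ (D_xs _)) h2].
by have := le_lt_trans (le_trans h1 (ler_norm _)) h2; rewrite ltxx.
Qed.

Lemma asym_unique f g P Q :
  asym f P -> asym g Q -> vanishing (fun x => f x - g x) -> P = Q.
Proof.
move=> hf hg h; apply/eqP; rewrite -subr_eq0; apply/eqP/vanishing_horner.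
have := vanishingD h (vanishingD (vanishingN (rapid_vanishing hf)) (rapid_vanishing hg)).
by apply: eq_vanishing => x _; rewrite hornerD hornerN; ring.
Qed.

(** By the bound for k = 1 the values along the cofinal sequence [xs] are Cauchy; letting y run
    through that sequence in the bound for k gives the rate at every x. *)
Lemma rapid_tail f :
  (forall k, exists C : R, forall x y, D x -> D y -> L x <= L y ->
     `|f y - f x| * (1 + L x) ^+ k <= C) ->
  exists l : R, asym f l%:P.
Proof.
move=> h.
have [|l hl] := @cauchy_is_lim_seq (f \o xs).
  move=> e e0; have [C hC] := h 1%N.
  have [N hN] := L_xs (`|C| / e); exists N.
  have main n m : (N <= n)%N -> (N <= m)%N -> L (xs n) <= L (xs m) ->
      `|f (xs m) - f (xs n)| < e.
    move=> /hN hn _ nm; have := hC _ _ (D_xs n) (D_xs m) nm.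
    have := L1_ge1 (D_xs n); rewrite expr1 => h1 h2.
    have h3 : `|C| < (1 + L (xs n)) * e by rewrite -ltr_pdivrMr //; lra.
    rewrite -(ltr_pM2r (lt_le_trans ltr01 h1)) [e * _]mulrC.
    by apply: le_lt_trans h2 (le_lt_trans (ler_norm C) h3).
  move=> n m nN mN; have [/main|/ltW/main] := leP (L (xs n)) (L (xs m)).
    by rewrite distrC; apply.
  by apply.
exists l => k; have [C hC] := h k; exists C => x Dx; rewrite hornerC.
rewrite leNgt; apply/negP => hlt.
have X0 := L1X_gt0 k Dx.
(* The tolerance is the amount by which the bound would fail at x. *)
have /is_lim_seqE/(_ (`|f x - l| - C / (1 + L x) ^+ k))[|N hN] := hl.
  by rewrite subr_gt0 ltr_pdivrMr.
have [N' hN'] := L_xs (L x).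
have h1 := hN (maxn N N') (leq_maxl _ _).
have h2 := hC _ _ Dx (D_xs _) (hN' (maxn N N') (leq_maxr _ _)).
move: h2; rewrite -ler_pdivlMr // => h2.
have := ler_normD (f x - f (xs (maxn N N'))) (f (xs (maxn N N')) - l).
rewrite addrA subrK [`|f x - f _|]distrC => h3.
by move: h1 h2 h3; rewrite /comp; lra.
Qed.

End Unbounded.
End Asymptotics.

(** * Expansions of truncated sums *)

Notation harm := (trunc1 1 false).

Lemma term1 n : term 1 false n = n%:R^-1.
Proof. by rewrite /term sgnE expr1n expr1 mul1r. Qed.

Lemma harmS n : harm n.+1 = harm n + n.+1%:R^-1.
Proof. by rewrite trunc1S term1. Qed.

Lemma harm_ge0 n : 0 <= harm n.
Proof. by elim: n => [|n IH]; rewrite ?lexx // harmS addr_ge0 // invr_ge0. Qed.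

Lemma ltr_harm m n : (m < n)%N -> harm m < harm n.
Proof.
elim: n => // n IH; rewrite ltnS leq_eqVlt harmS => /orP[/eqP ->|/IH h].
  by rewrite ltrDl invr_gt0 ltr0n.
by apply: lt_trans h _; rewrite ltrDl invr_gt0 ltr0n.
Qed.

Lemma ler_harm m n : (harm m <= harm n) = (m <= n)%N.
Proof.
have [mn|nm] := leqP m n; last by rewrite leNgt ltr_harm.
by move: mn; rewrite leq_eqVlt => /orP[/eqP ->|/ltr_harm/ltW ->]; rewrite ?lexx.
Qed.

Lemma harm_ge1 n : (0 < n)%N -> 1 <= harm n.
Proof. by rewrite -ler_harm harmS invr1 add0r. Qed.

(** The step factor exp(1/(n+1)) is at least (n+2)/(n+1). Together with [exp_harm_le] this makes
    exp(harm n) of order n, which relates powers of n to the scale without logarithms. *)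
Lemma exp_harm_ge n : n.+1%:R <= exp (harm n).
Proof.
elim: n => [|n IH]; first by rewrite exp_0.
rewrite harmS -expRD; have n0 : 0 < n.+1%:R :> R by rewrite ltr0n.
have /RleP := exp_ineq1_le (n.+1%:R^-1); rewrite RplusE => h.
have h' : 0 <= 1 + n.+1%:R^-1 :> R by rewrite addr_ge0 ?invr_ge0.
apply: le_trans (ler_pM (ler0n _ _) h' IH h).
by rewrite mulrDr mulr1 divff ?gt_eqF // -[n.+2]addn1 natrD.
Qed.

(** The step factor exp(1/(n+2)) is at most (n+2)/(n+1), because exp(-1/(n+2)) >= (n+1)/(n+2). *)
Lemma exp_harm_le n : exp (harm n.+1) <= exp 1 * n.+1%:R.
Proof.
elim: n => [|n IH]; first by rewrite harmS add0r invr1 mulr1.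
rewrite harmS -expRD.
have n0 : 0 < n.+1%:R :> R by rewrite ltr0n.
have n1 : 0 < n.+2%:R :> R by rewrite ltr0n.
have e0 (x : R) : 0 < exp x by apply/RltP/exp_pos.
have h : exp (n.+2%:R^-1) * n.+1%:R <= n.+2%:R.
  have /RleP := exp_ineq1_le (- n.+2%:R^-1).
  move/(ler_wpM2l (ltW (e0 n.+2%:R^-1))); rewrite RplusE expRD RplusE subrr expR0.
  move=> /(ler_wpM2r (ltW n1)); rewrite mul1r; apply: le_trans.
  rewrite -mulrA ler_wpM2l ?(ltW (e0 _)) //.
  by rewrite mulrDl mul1r mulNr mulVf ?gt_eqF // -[n.+2]addn1 natrD addrK.
apply: le_trans (ler_wpM2r (ltW (e0 _)) IH) _.
by rewrite -mulrA ler_wpM2l ?(ltW (e0 _)) // mulrC.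
Qed.

Lemma harm_unbounded (B : R) : exists N, forall n, (N <= n)%N -> B <= harm n.
Proof.
have /archi_boundP : 0 <= exp B by apply/RleP/Rlt_le/exp_pos.
set N := Num.bound _ => hN; exists N => n Nn.
rewrite leNgt; apply/negP => /RltP/exp_increasing/RltP h.
have := exp_harm_ge n; have : N%:R <= n.+1%:R :> R by rewrite ler_nat ltnW.
by move: hN h; lra.
Qed.

Notation rapidN := (rapid (fun=> True) harm).
Notation asymN := (asym (fun=> True) harm).

Lemma harm_ge0_on (n : nat) : True -> 0 <= harm n.
Proof. by move=> _; apply: harm_ge0. Qed.

Lemma rapid_inv : rapidN (fun n => n.+1%:R^-1).
Proof.
move=> k; have [C C0 hC] := exp_ge_power k; exists (C * exp 1) => n _.
have e1 : 1 <= exp 1.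
  by have /RleP := exp_ineq1_le 1; rewrite RplusE; apply: le_trans; rewrite lerDl ler01.
rewrite ger0_norm ?invr_ge0 // mulrC ler_pdivrMr ?ltr0n //.
apply: le_trans (hC _ (harm_ge0 n)) _; rewrite -mulrA ler_wpM2l ?(ltW C0) //.
case: n => [|n]; first by rewrite exp_0 mulr1.
apply: le_trans (exp_harm_le n) _; by rewrite ler_wpM2l ?ler_nat // (le_trans ler01 e1).
Qed.

(** Increments of the form rapid/(n+1) are summed by telescoping: (1 + harm n)^-(k+1) drops by at
    least (1 + harm (n+1))^-(k+2) / (n+1) at each step. *)
Lemma rapid_seq_tail (s : nat -> R) :
  rapidN (fun n => (s n.+1 - s n) * n.+1%:R) -> exists l : R, asymN s l%:P.
Proof.
move=> h; apply: (rapid_tail harm_ge0_on (xs := id)) => // [|k]; first exact: harm_unbounded.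
(* One power is spent on the summation; the other keeps the telescoping majorant non-constant when k
   = 0. The factor 2^(k+2) pays for 1 + harm (n+1) <= 2 (1 + harm n). *)
have [C hC] := h k.+2; pose C' : R := 2 ^+ k.+2 * C.
have C'0 : 0 <= C'.
  rewrite mulr_ge0 ?exprn_ge0 //; apply: le_trans (hC 0 I).
  by rewrite mulr_ge0 ?exprn_ge0 // addr_ge0 ?harm_ge0.
have y0 n : 1 <= 1 + harm n by have := harm_ge0 n; lra.
pose g n : R := (1 + harm n) ^- k.+1.
have g0 n : 0 < g n by rewrite invr_gt0 exprn_gt0 //; have := y0 n; lra.
have step n : `|s n.+1 - s n| <= C' * (g n - g n.+1).
  have n0 : 0 < n.+1%:R :> R by rewrite ltr0n.
  have /andP[hd hd'] : 0 < (n.+1%:R^-1 : R) <= 1.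
    by rewrite invr_gt0 n0 invf_le1 // ler1n.
  have h1 := hC n I; have h2 := harmS n; have h3 := y0 n; have h4 := y0 n.+1.
  have h7 : harm n <= harm n.+1 by rewrite ler_harm.
  have h5 : `|s n.+1 - s n| <= C' * (n.+1%:R^-1 * (1 + harm n.+1) ^- k.+2).
    rewrite mulrA ler_pdivlMr ?exprn_gt0 //; last lra.
    rewrite ler_pdivlMr //.
    have h6' : 1 + harm n.+1 <= 2 * (1 + harm n).
      by rewrite h2; move: hd' h3; move: (_^-1) (harm n) => y z; lra.
    have h6 : (1 + harm n.+1) ^+ k.+2 <= 2 ^+ k.+2 * (1 + harm n) ^+ k.+2.
      by rewrite -exprMn lerXn2r ?nnegrE //; lra.
    rewrite mulrAC; apply: le_trans (ler_wpM2l _ h6) _; first by rewrite mulr_ge0.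
    rewrite mulrCA ler_wpM2l ?exprn_ge0 //.
    by move: h1; rewrite normrM (ger0_norm (ltW n0)).
  apply: le_trans h5 _; rewrite ler_wpM2l // /g.
  have : (1 + harm n.+1) ^- k <= (1 + harm n) ^- k.
    by rewrite lef_pV2 ?posrE ?exprn_gt0 ?lerXn2r ?nnegrE //; lra.
  have : 0 < (1 + harm n.+1) ^- k by rewrite invr_gt0 exprn_gt0 //; lra.
  rewrite !exprS !invfM.
  have ya : (1 + harm n)^-1 - (1 + harm n.+1)^-1 =
      n.+1%:R^-1 * (1 + harm n)^-1 * (1 + harm n.+1)^-1.
    have : 1 + harm n.+1 != 0 by rewrite gt_eqF //; lra.
    have : 1 + harm n != 0 by rewrite gt_eqF //; lra.
    rewrite h2 addrA; move: (1 + harm n) (n.+1%:R^-1) => y z yz0 y0'.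
    by field; rewrite yz0 y0'.
  have ya' : (1 + harm n.+1)^-1 <= (1 + harm n)^-1 by rewrite lef_pV2 ?posrE //; lra.
  have a0 : 0 < (1 + harm n.+1)^-1 by rewrite invr_gt0; lra.
  move: ya ya' a0 hd;
  move: ((1 + harm n.+1) ^- k) ((1 + harm n) ^- k) (1 + harm n)^-1 (1 + harm n.+1)^-1 (n.+1%:R^-1).
  move=> q p y y' z yE y'y y'0 z0 q0 qp.
  have t1 : 0 <= y * (p - q) by rewrite mulr_ge0 //; lra.
  have t2 : 0 <= q * z * y' * (y - y') by rewrite !mulr_ge0 //; lra.
  have t3 : (y - y') * q = z * y * y' * q by rewrite yE.
  lra.
clearbody C'.
have mono n m : (n <= m)%N -> `|s m - s n| <= C' * (g n - g m).
  move=> nm; rewrite -(subnKC nm); elim: (m - n)%N => [|j IH].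
    by rewrite addn0 !subrr normr0 mulr0.
  rewrite addnS; have := step (n + j)%N.
  have := ler_normD (s (n + j).+1 - s (n + j)%N) (s (n + j)%N - s n).
  by rewrite addrA subrK; lra.
exists C' => n m _ _; rewrite ler_harm => nm.
have y1 : 0 < 1 + harm n by have := y0 n; lra.
apply: le_trans (_ : C' * g n * (1 + harm n) ^+ k <= _).
  rewrite ler_wpM2r ?exprn_ge0 ?(ltW y1) //; apply: le_trans (mono _ _ nm) _.
  by rewrite ler_wpM2l // gerBl ltW.
rewrite /g [_ ^+ k.+1]exprS invfM -!mulrA mulVf ?mulr1 ?expf_neq0 ?gt_eqF //.
by rewrite ler_piMr // invf_le1.
Qed.

(** [V] is a guessed discrete primitive: matching increments suffice, and the limit of s - V
    produces the constant. *)
Lemma asym_seq_sum (s V : nat -> R) Q : asymN V Q ->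
  rapidN (fun n => (s n.+1 - s n - (V n.+1 - V n)) * n.+1%:R) ->
  exists c : R, asymN s (Q + c%:P).
Proof.
move=> hV hs; have [|c hc] := @rapid_seq_tail (fun n => s n - V n).
  by apply: eq_rapid hs => n _; congr (_ * _); ring.
by exists c; apply: eq_asym (asymD harm_ge0_on hV hc) => n _; rewrite addrC subrK.
Qed.

Lemma asym_harmS : asymN (fun n => harm n.+1) 'X.
Proof.
have := asymD harm_ge0_on (asym_horner _ _ 'X) (rapid_asym0 rapid_inv).
by rewrite addr0; apply: eq_asym => n _; rewrite hornerX harmS.
Qed.

Lemma asym_shift P : asymN (fun n => P.[harm n.+1]) P.
Proof. by have := asym_comp harm_ge0_on P asym_harmS; rewrite comp_polyXr. Qed.

(** Since [harm] has step 1/(n+1), this is a discrete chain rule; it makes Q(harm) a primitive of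
    Q'(harm)/(n+1). *)
Lemma asym_deriv Q : asymN (fun n => (Q.[harm n.+1] - Q.[harm n]) * n.+1%:R) Q^`().
Proof.
elim/poly_ind: Q => [|Q c IH].
  by rewrite deriv0; apply: eq_asym (asymC _ _ 0) => n _; rewrite !horner0 subrr mul0r.
rewrite derivD derivC addr0 derivM derivX mulr1.
apply: eq_asym (asymD harm_ge0_on (asymM harm_ge0_on IH asym_harmS) (asym_horner _ _ Q)) => n _.
rewrite !hornerMXaddC harmS.
have : n.+1%:R != 0 :> R by rewrite pnatr_eq0.
by move: n.+1%:R => N N0; field; rewrite N0.
Qed.

Lemma poly_antideriv (P : {poly R}) : exists Q : {poly R}, Q^`() = P.
Proof.
exists (\poly_(i < (size P).+1) (P`_i.-1 / i%:R)); apply/polyP => i.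
rewrite coef_deriv coef_poly ltnS; case: ltnP => [_|h].
  by rewrite -[LHS]mulr_natr divfK // pnatr_eq0.
by rewrite mul0rn nth_default.
Qed.

Definition admissible (l : eindex) : bool := all (fun p => 0 < p.1)%N l.

Definition convergent (l : eindex) : bool :=
  if l is p :: _ then p != (1%N, false) else true.

(** The leading argument decides. For s >= 2 the increments are already rapid/(n+1), and for a
    barred 1 the alternation cancels, so only a constant arises, whatever the expansion P of the
    tail. An unbarred 1 integrates P. *)
Lemma asym_trunc_zeta l : admissible l ->
  exists2 P, asymN (trunc_zeta l) P & convergent l -> exists c : R, P = c%:P.
Proof.
elim: l => [_|[s b] l IH /= /andP[s0 /IH[P hP _]]].
  by exists 1%:P; [apply: asymC|exists 1].
have stepE n : trunc_zeta ((s, b) :: l) n.+1 - trunc_zeta ((s, b) :: l) n =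
    term s b n.+1 * trunc_zeta l n by rewrite trunc_zetaS addrC addKr.
have slow1 k : slow (fun=> True) harm (fun n => sgn b ^+ n.+1 * n.+1%:R ^- k).
  exists 0, 1 => n _; rewrite mul1r expr0 normrM normr_sgnX mul1r.
  rewrite normrV ?unitfE ?expf_neq0 ?pnatr_eq0 // invf_le1 ?normr_gt0 ?expf_neq0 ?pnatr_eq0 //.
  by rewrite normrX ger0_norm // exprn_ege1 // ler1n.
have nz n : n.+1%:R != 0 :> R by rewrite pnatr_eq0.
case: s s0 stepE => [//|[|s]] _ stepE; last first.
  have [| |c hc] := @asym_seq_sum (trunc_zeta ((s.+2, b) :: l)) (fun=> 0) 0.
  - exact: asymC.
  - have := rapidM harm_ge0_on (asym_slow harm_ge0_on hP) (rapidM harm_ge0_on (slow1 s) rapid_inv).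
    apply: eq_rapid => n _; rewrite stepE /term subrr subr0 !exprS.
    have : n.+1%:R ^+ s != 0 :> R by rewrite expf_neq0.
    move: (_ ^+ s) (nz n); move: n.+1%:R => N y y0 N0.
    by field; rewrite N0 y0.
  by exists (0 + c%:P); rewrite // add0r; exists c.
case: b slow1 stepE => slow1 stepE.
  (* Consecutive values of V have opposite signs and nearly equal size, so V(n+1) - V(n) is close to
     (-1)^(n+1) P(harm n)/(n+1); hence the factor 1/2. V itself is rapid and adds nothing to the
     expansion. *)
  pose V n : R := sgn true ^+ n * P.[harm n] / 2 * n.+1%:R^-1.
  have hV : asymN V 0.
    have sl : slow (fun=> True) harm (fun n => sgn true ^+ n).
      by exists 0, 1 => n _; rewrite normr_sgnX expr0 mulr1.
    apply: rapid_asym0.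
    exact: (rapidM harm_ge0_on
      (slowM (slowM sl (slow_horner harm_ge0_on P)) (slow_cst _ _ 2^-1)) rapid_inv).
  have [|c hc] := asym_seq_sum (s := trunc_zeta ((1%N, true) :: l)) hV.
    have h1 : asymN (fun n => 1 - n.+2%:R^-1) 1.
      suff hi : asymN (fun n => n.+2%:R^-1) 0.
        by have := asymB harm_ge0_on (asymC _ _ 1) hi; rewrite subr0 polyC1.
      apply: rapid_asym0 => k; have [C hC] := rapid_inv k; exists C => n _.
      apply: le_trans (hC n I); rewrite ler_wpM2r ?exprn_ge0 ?addr_ge0 ?harm_ge0 //.
      by rewrite !ger0_norm ?invr_ge0 // lef_pV2 ?posrE ?ltr0n // ler_nat.
    have := asymB harm_ge0_on hP (asymD harm_ge0_on
      (asymZ harm_ge0_on 2^-1 (asymM harm_ge0_on (asym_shift P) h1))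
      (asymZ harm_ge0_on 2^-1 (asym_horner _ _ P))).
    rewrite mulr1 -scalerDl (_ : 2^-1 + 2^-1 = 1) ?scale1r ?subrr; last by field.
    move/asym0_rapid/(rapidM harm_ge0_on (slow1 0)); apply: eq_rapid => n _.
    rewrite stepE /V /term expr0 expr1 !exprS (_ : sgn true = -1) ?sgnE //.
    have n2 : n.+2%:R != 0 :> R by rewrite pnatr_eq0.
    move: (nz n) n2; rewrite -[n.+2]addn1 natrD.
    by move: n.+1%:R => N N0 N1; field; rewrite N0 N1.
  by exists (0 + c%:P); rewrite // add0r; exists c.
have [Q QP] := poly_antideriv P.
have [|c hc] := asym_seq_sum (s := trunc_zeta ((1%N, false) :: l)) (asym_horner _ _ Q).
  have := asymB harm_ge0_on hP (asym_deriv Q); rewrite QP subrr => /asym0_rapid.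
  apply: eq_rapid => n _; rewrite stepE term1 [RHS]mulrBl mulrAC mulVf ?mul1r //.
by exists (Q + c%:P).
Qed.

Lemma vanishing_is_lim_seq (r : nat -> R) : vanishing (fun=> True) harm r <-> is_lim_seq r (0 : R).
Proof.
rewrite is_lim_seqE; split=> h e /h[B hB].
  have [N hN] := harm_unbounded B; exists N => n /hN Bn.
  by rewrite subr0 hB.
by exists (harm B) => n _; rewrite ler_harm => /hB; rewrite subr0.
Qed.

Lemma asym_is_lim_seq (f : nat -> R) (c : R) : asymN f c%:P -> is_lim_seq f c.
Proof.
move=> /(rapid_vanishing harm_ge0_on)/vanishing_is_lim_seq/is_lim_seqE h.
apply/is_lim_seqE => e /h[N hN]; exists N => n /hN.
by rewrite hornerC subr0.
Qed.

Lemma asymN_unique f g P Q :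
  asymN f P -> asymN g Q -> is_lim_seq (fun n => f n - g n) (0 : R) -> P = Q.
Proof.
move=> hf hg /vanishing_is_lim_seq h.
by apply: (asym_unique harm_ge0_on (xs := id)) h => //; apply: harm_unbounded.
Qed.

(** * Harmonic numbers and the logarithm *)

Lemma ln_le_sub1 (x : R) : 0 < x -> ln x <= x - 1.
Proof.
move=> x0; have /RleP := exp_ineq1_le (ln x); rewrite exp_ln; last exact/RltP.
by rewrite RplusE -lerBrDl.
Qed.

Lemma lnM (x y : R) : 0 < x -> 0 < y -> ln (x * y) = ln x + ln y.
Proof. by move=> /RltP x0 /RltP y0; rewrite -RmultE ln_mult. Qed.

Lemma lnV (x : R) : 0 < x -> ln x^-1 = - ln x.
Proof. by move=> /RltP x0; rewrite -RinvE ln_Rinv. Qed.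

Lemma ln_step (n : nat) :
  n.+2%:R^-1 <= ln n.+2%:R - ln n.+1%:R <= n.+1%:R^-1.
Proof.
have n0 : 0 < n.+1%:R :> R by rewrite ltr0n.
have n1 : 0 < n.+2%:R :> R by rewrite ltr0n.
have e : n.+2%:R = n.+1%:R + 1 :> R by rewrite -[n.+2]addn1 natrD.
apply/andP; split.
  have := ln_le_sub1 (divr_gt0 n0 n1); rewrite lnM ?invr_gt0 // lnV //.
  have -> : n.+1%:R / n.+2%:R = 1 - n.+2%:R^-1 :> R.
    by move: n1; rewrite e; move: n.+1%:R => N N0; field; rewrite gt_eqF.
  by move: (ln _) (ln _) (_^-1) => x y z; lra.
have := ln_le_sub1 (divr_gt0 n1 n0); rewrite lnM ?invr_gt0 // lnV //.
have -> : n.+2%:R / n.+1%:R = 1 + n.+1%:R^-1 :> R.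
  by rewrite e; move: n.+1%:R n0 => N N0; field; rewrite gt_eqF.
by move: (ln _) (ln _) (_^-1) => x y z; lra.
Qed.

(** The increments of harm n - ln (n+1) are O(n^-2), so the sequence has a limit with rapid error,
    and this limit is Euler's constant. *)
Lemma asym_ln_gamma : asymN (fun n => ln (INR n) + euler_gamma) 'X.
Proof.
have [|c hc] := @rapid_seq_tail (fun n => harm n - ln n.+1%:R).
  move=> k; have [C hC] := rapid_inv k; exists C => n _.
  apply: le_trans (hC n I); rewrite ler_wpM2r ?exprn_ge0 ?addr_ge0 ?harm_ge0 //.
  have n0 : 0 < n.+1%:R :> R by rewrite ltr0n.
  rewrite normrM [`|_^-1|]ger0_norm ?invr_ge0 // [`|n.+1%:R|]ger0_norm //.
  rewrite -ler_pdivlMr // -invfM harmS.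
  have /andP[] := ln_step n.
  have : n.+1%:R^-1 - n.+2%:R^-1 <= (n.+1%:R * n.+1%:R)^-1 :> R.
    have n1 : 0 < n.+2%:R :> R by rewrite ltr0n.
    have -> : n.+1%:R^-1 - n.+2%:R^-1 = (n.+1%:R * n.+2%:R)^-1 :> R.
      move: n1; rewrite -[n.+2]addn1 natrD; move: n.+1%:R n0 => N N0 N1.
      by field; rewrite !gt_eqF.
    by rewrite lef_pV2 ?posrE ?mulr_gt0 // ler_pM2l // ler_nat.
  rewrite ler_norml => h1 h2 h3.
  have h4 : 0 <= (n.+1%:R * n.+1%:R)^-1 :> R by rewrite invr_ge0 mulr_ge0.
  move: h1 h2 h3 h4; move: (ln _) (ln _) (_^-1) (_^-1) (_^-1) => x y z t v.
  by move=> *; apply/andP; split; lra.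
(* The definition of [euler_gamma] uses harm (n+1) - ln (n+1), which exceeds the sequence at hand by
   1/(n+1). *)
have -> : euler_gamma = c.
  rewrite /euler_gamma (@is_lim_seq_unique _ c) //.
  apply: asym_is_lim_seq; have := asymD harm_ge0_on hc (rapid_asym0 rapid_inv); rewrite addr0.
  apply: eq_asym => n _; rewrite RminusE INRE addrAC -harmS; congr (_ - _).
  rewrite sum_f_R0E trunc1_sum big_add1 /=.
  by apply: eq_bigr => i _; rewrite term1 -INRE.
have hr : asymN (fun n => ln (INR n) - ln n.+1%:R) 0.
  apply: rapid_asym0 => k; have [C hC] := rapid_inv k.
  (* At n = 0 the default value of [ln] at 0 enters; the maximum absorbs it. *)
  exists (Num.max `|ln (INR 0) - ln 1| (2 * C)) => n _; rewrite le_max.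
  case: n => [|n]; apply/orP; [left|right].
    by rewrite addr0 expr1n mulr1.
  rewrite INRE; have /andP[h1 h2] := ln_step n.
  have y0 : 0 <= (1 + harm n.+1) ^+ k by rewrite exprn_ge0 // addr_ge0 ?harm_ge0.
  apply: le_trans (ler_wpM2l _ (hC n.+1 I)) => //; rewrite mulrA ler_wpM2r //.
  rewrite [`|_^-1|]ger0_norm ?invr_ge0 // distrC ger0_norm; last first.
    by apply: le_trans h1; rewrite invr_ge0.
  apply: le_trans h2 _; rewrite ler_pdivlMr ?ltr0n // mulrC ler_pdivrMr ?ltr0n //.
  by rewrite -natrM ler_nat; lia.
have := asymD harm_ge0_on (asymB harm_ge0_on hr hc)
  (asymD harm_ge0_on (asymC _ _ c) (asym_horner _ _ 'X)).
rewrite sub0r addKr; apply: eq_asym => n _; rewrite hornerX; ring.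
Qed.

(** The expansion of ln M + gamma is 'X, so passing to the scale [harm] leaves every polynomial
    unchanged; uniqueness then pins down the choice made by [epsilon]. *)
Lemma is_zeta_starE l P Q : asymN (trunc_zeta l) P -> is_zeta_star l Q <-> P = Q.
Proof.
have cQ (S : {poly R}) : asymN (fun M => S.[ln (INR M) + euler_gamma]) S.
  by have := asym_comp harm_ge0_on S asym_ln_gamma; rewrite comp_polyXr.
move=> hP; split=> [h|<-]; first exact: asymN_unique hP (cQ Q) h.
have := asymB harm_ge0_on hP (cQ P); rewrite subrr => /asym0_rapid/(rapid_vanishing harm_ge0_on).
by move/vanishing_is_lim_seq.
Qed.

Lemma zeta_star_asym l : admissible l -> asymN (trunc_zeta l) (zeta_star l).
Proof.
move=> /asym_trunc_zeta[P hP _].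
have h : exists Q, is_zeta_star l Q by exists P; apply/is_zeta_starE.
suff <- : P = zeta_star l by [].
exact: (iffLR (is_zeta_starE _ hP) (epsilon_spec (inhabits 0%R) _ h)).
Qed.

Lemma zeta_asym l : admissible l -> convergent l -> asymN (trunc_zeta l) (zetaP l).
Proof.
move=> /asym_trunc_zeta[P hP cP] /cP[c Pc]; rewrite {}Pc in hP.
by rewrite /zetaP /zeta (is_lim_seq_unique _ _ (asym_is_lim_seq hP)).
Qed.

(** * The cost of replacing M - n by M *)

Lemma dist_trunc1 s e m n : (0 < s)%N -> (m <= n)%N ->
  `|trunc1 s e n - trunc1 s e m| <= harm n - harm m.
Proof.
move=> s0 mn; rewrite -(subnKC mn); elim: (n - m)%N => [|j IH].
  by rewrite addn0 !subrr normr0.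
rewrite addnS trunc1S harmS addrAC [X in _ <= X]addrAC.
apply: le_trans (ler_normD _ _) _; apply: lerD => //.
rewrite /term normrM normr_sgnX mul1r normrV ?unitfE ?expf_neq0 ?pnatr_eq0 //.
rewrite normrX ger0_norm // lef_pV2 ?posrE ?exprn_gt0 ?ltr0n //.
by rewrite -{1}[X in X <= _]expr1 ler_weXn2l // ler1n.
Qed.

(* The last [n] terms of the harmonic sum are its smallest ones. *)
Lemma harm_diff_le M n : (n <= M)%N -> M%:R * (harm M - harm (M - n)) <= n%:R * harm M.
Proof.
have h N j : N%:R * (harm (N + j) - harm N) <= j%:R.
  elim: j => [|j IH]; first by rewrite addn0 subrr mulr0.
  rewrite addnS harmS addrAC mulrDr -[X in _ <= X%:R]addn1 natrD; apply: lerD => //.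
  by rewrite ler_pdivrMr ?ltr0n // mul1r ler_nat; lia.
(* With M = (M - n) + n, the part M - n contributes at most n, which is absorbed by n * harm (M - n)
   unless M = n. *)
move=> nM; have /= := h (M - n)%N n; rewrite subnK //.
have -> : M%:R = (M - n)%N%:R + n%:R :> R by rewrite -natrD subnK.
have [->|N0] := posnP (M - n)%N; first by rewrite add0r subr0.
have : 0 <= n%:R * (harm (M - n) - 1) by rewrite mulr_ge0 // subr_ge0 harm_ge1.
move: (harm M) (harm _) (n%:R : R) ((M - n)%N%:R : R) => x y z t; lra.
Qed.

Lemma norm_tail1_le e K M n : (K <= M)%N -> (n.-1 <= M)%N -> `|tail1 e K n| <= harm M.
Proof.
have aux i j : (i <= j)%N -> (j <= M)%N -> `|trunc1 1 e j - trunc1 1 e i| <= harm M.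
  move=> ij jM; apply: le_trans (dist_trunc1 e _ ij) _ => //.
  by have := harm_ge0 i; move: jM; rewrite -ler_harm; lra.
move=> KM nM; rewrite /tail1; have [/aux|/ltnW/aux] := leqP n.-1 K; first exact.
by rewrite distrC; apply.
Qed.

Lemma norm_term_le s e n : (2 <= s)%N -> (0 < n)%N -> `|term s e n| <= n%:R ^- 2.
Proof.
move=> s2 n0; have n1 : 1 <= n%:R :> R by rewrite ler1n.
rewrite /term normrM normr_sgnX mul1r normrV ?unitfE ?expf_neq0 ?pnatr_eq0 -?lt0n //.
rewrite normrX ger0_norm // lef_pV2 ?posrE ?exprn_gt0 ?ltr0n //.
exact: ler_weXn2l.
Qed.

(** Each bracket moves by at most y = harm M - harm (M - n), and [harm_diff_le] gives y <= 2 n harm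
    M / (M+1). Of the factor n^-2 provided by u >= 2, one power cancels this n and the other sums to
    harm M. *)
Lemma triple_sum_error u b c d : (2 <= u)%N ->
  is_lim_seq (fun M => triple_sum u b c d (fun n => M - n)%N M
                       - triple_sum u b c d (fun=> M) M) (0 : R).
Proof.
move=> u2; apply/vanishing_is_lim_seq/(rapid_vanishing harm_ge0_on).
(* Three products of tails move by 2 * harm M * y each, three tails weighted by u by u * y each, and
   three [join2] by y each. *)
pose Q M : R := 2 * (6 * harm M + 3 * u%:R + 3) * harm M * harm M.
have sQ : slow (fun=> True) harm Q.
  have sH := slow_L harm_ge0_on; have sc := slow_cst (fun=> True) harm.
  exact: slowM (slowM (slowM (sc _)
    (slowD harm_ge0_on (slowD harm_ge0_on (slowM (sc _) sH) (sc _)) (sc _))) sH) sH.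
move=> k; have [C hC] := rapidM harm_ge0_on sQ rapid_inv k; exists C => M _.
apply: le_trans (hC M I); rewrite ler_wpM2r ?exprn_ge0 ?addr_ge0 ?harm_ge0 // => {k C hC sQ}.
have HM0 := harm_ge0 M.
have Q0 : 0 <= 6 * harm M + 3 * u%:R + 3 by rewrite !addr_ge0 ?mulr_ge0.
rewrite [X in _ <= X]ger0_norm; last by rewrite !mulr_ge0 ?invr_ge0.
rewrite /triple_sum -sumrB; apply: le_trans (ler_norm_sum _ _ _) _.
pose P : R := 2 * (6 * harm M + 3 * u%:R + 3) * harm M / M.+1%:R.
have -> : Q M / M.+1%:R = \sum_(1 <= n < M.+1) P * n%:R^-1.
  have HE : \sum_(1 <= n < M.+1) n%:R^-1 = harm M.
    by rewrite trunc1_sum; apply: eq_bigr => n _; rewrite term1.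
  by rewrite -mulr_sumr HE /P /Q; ring.
rewrite big_nat_cond [X in _ <= X]big_nat_cond; apply: ler_sum => n /andP[/andP[n0 nM] _].
have nM' : (n <= M)%N by [].
have M0 : (0 < M)%N by apply: leq_trans n0 _.
pose y := harm M - harm (M - n).
have y0 : 0 <= y by rewrite subr_ge0 ler_harm leq_subr.
have A0 e : `|tail1 e M n| <= harm M by apply: norm_tail1_le => //; lia.
have A1 e : `|tail1 e (M - n) n| <= harm M by apply: norm_tail1_le => //; lia.
have A2 e : `|tail1 e (M - n) n - tail1 e M n| <= y.
  by rewrite /tail1 opprB addrA subrK distrC dist_trunc1 // leq_subr.
have A3 e : `|join2 e (M - n) n - join2 e M n| <= y.
  rewrite /join2 opprD addrACA subrr addr0 distrC dist_trunc1 // leq_subr //.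
have pairs e f : `|tail1 e (M - n) n * tail1 f (M - n) n - tail1 e M n * tail1 f M n|
    <= 2 * harm M * y.
  have -> : tail1 e (M - n) n * tail1 f (M - n) n - tail1 e M n * tail1 f M n =
    (tail1 e (M - n) n - tail1 e M n) * tail1 f (M - n) n
    + tail1 e M n * (tail1 f (M - n) n - tail1 f M n) by ring.
  apply: le_trans (ler_normD _ _) _; rewrite !normrM.
  have h1 := ler_pM (normr_ge0 _) (normr_ge0 _) (A2 e) (A1 f).
  have h2 := ler_pM (normr_ge0 _) (normr_ge0 _) (A0 e) (A2 f).
  lra.
have T0 := norm_term_le (b (+) c (+) d) u2 n0.
have T1 := norm_term_le (b (+) c (+) d) (leqW u2) n0.
have yP : n%:R ^- 2 * (y * (6 * harm M + 3 * u%:R + 3)) <= P * n%:R^-1.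
  have n1 : 0 < n%:R :> R by rewrite ltr0n.
  have h1 : y <= 2 * n%:R * harm M / M.+1%:R.
    have := harm_diff_le nM'; rewrite -/y => h1; rewrite ler_pdivlMr ?ltr0n //.
    have : M.+1%:R <= 2 * M%:R :> R by rewrite -natrM ler_nat; lia.
    by move=> /(ler_wpM2l y0) h2; move: h1 h2; lra.
  have h2 : y * (6 * harm M + 3 * u%:R + 3) <= P * n%:R.
    apply: le_trans (ler_wpM2r Q0 h1) _; rewrite le_eqVlt; apply/orP; left; apply/eqP.
    by rewrite /P; ring.
  apply: le_trans (ler_wpM2l _ h2) _; first by rewrite invr_ge0 exprn_ge0 // ltW.
  rewrite le_eqVlt; apply/orP; left; apply/eqP; move: {h2} P (n%:R : R) n1 => p N N0.
  by field; rewrite gt_eqF.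
apply: le_trans yP.
move: (term u _ n) (term u.+1 _ n) (term u.+2 _ n) T0 T1 => t t1 t2 T0 T1.
rewrite [X in `|X|](_ : _ =
  t * ((tail1 c (M - n) n * tail1 d (M - n) n - tail1 c M n * tail1 d M n)
     + (tail1 b (M - n) n * tail1 d (M - n) n - tail1 b M n * tail1 d M n)
     + (tail1 b (M - n) n * tail1 c (M - n) n - tail1 b M n * tail1 c M n))
  + t1 * (u%:R * ((tail1 b (M - n) n - tail1 b M n) + (tail1 c (M - n) n - tail1 c M n)
                  + (tail1 d (M - n) n - tail1 d M n)))
  - t * ((join2 b (M - n) n - join2 b M n) + (join2 c (M - n) n - join2 c M n)
         + (join2 d (M - n) n - join2 d M n))); last by ring.
have n3 (x1 x2 x3 z : R) : `|x1| <= z -> `|x2| <= z -> `|x3| <= z -> `|x1 + x2 + x3| <= 3 * z.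
  by rewrite !ler_norml => /andP[? ?] /andP[? ?] /andP[? ?]; apply/andP; split; lra.
have Z1 := n3 _ _ _ _ (pairs c d) (pairs b d) (pairs b c).
have Z2 := n3 _ _ _ _ (A2 b) (A2 c) (A2 d).
have Z3 := n3 _ _ _ _ (A3 b) (A3 c) (A3 d).
have u0 : `|u%:R| = u%:R :> R by rewrite ger0_norm.
have Z2' := ler_wpM2l (ler0n R u) Z2; rewrite -{1}u0 -normrM in Z2'.
apply: le_trans (ler_normB _ _) _.
apply: le_trans (lerD (ler_normD _ _) (lexx _)) _; rewrite !(normrM t) (normrM t1).
have W1 := ler_pM (normr_ge0 _) (normr_ge0 _) T0 Z1.
have W2 := ler_pM (normr_ge0 _) (normr_ge0 _) T1 Z2'.
have W3 := ler_pM (normr_ge0 _) (normr_ge0 _) T0 Z3.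
apply: le_trans (lerD (lerD W1 W2) W3) _.
by rewrite le_eqVlt; apply/orP; left; apply/eqP; ring.
Qed.

(** * Power series and iterated integrals *)

Lemma CV_radius_gt (a : nat -> R) (C x : R) :
  (forall n, `|a n| <= C * n.+1%:R) -> `|x| < 1 -> Rbar_lt (Rabs x) (CV_radius a).
Proof.
move=> ha x1; pose r : R := (1 + `|x|) / 2.
have xr : `|x| < r by rewrite /r; lra.
have r1 : r < 1 by rewrite /r; lra.
have r0 : 0 <= r by apply: le_trans (normr_ge0 x) (ltW xr).
have [ub _] := CV_radius_bounded a.
apply: (Rbar_lt_le_trans _ r); first by rewrite RabsE; apply/RltP.
apply: ub; exists (C / (1 - r)) => n; apply/RleP; rewrite RabsE RpowE.
have C0 : 0 <= C.
  by have := ha 0; rewrite mulr1; apply: le_trans.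
(* That is, (n+1) r^n <= 1 + r + ... + r^n, whence the bound C / (1 - r). *)
have h : n.+1%:R * r ^+ n * (1 - r) <= 1 - r ^+ n.+1.
  elim: n => [|n IH]; first by rewrite mul1r expr0 mul1r expr1.
  have q0 : 0 <= r ^+ n.+1 by rewrite exprn_ge0.
  have q1 : r ^+ n.+1 <= 1 by rewrite exprn_ile1 // ltW.
  have e : (1 + n.+1%:R) * r ^+ n.+1 * (1 - r)
      = r * (n.+1%:R * r ^+ n * (1 - r)) + r ^+ n.+1 * (1 - r) by rewrite exprS; ring.
  rewrite -[n.+2]add1n natrD e [r ^+ n.+2]exprS.
  have := ler_wpM2l r0 IH.
  have : 0 <= (1 - r ^+ n.+1) * (1 - r) by rewrite mulr_ge0 // subr_ge0 // ltW.
  by move: (r ^+ n.+1) => q; lra.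
rewrite RmultE normrM normrX (ger0_norm r0) ler_pdivlMr ?subr_gt0 //.
apply: le_trans (_ : C * (n.+1%:R * r ^+ n * (1 - r)) <= _).
  rewrite !mulrA ler_wpM2r ?subr_ge0 ?(ltW r1) // ler_wpM2r ?exprn_ge0 //.
rewrite ler_piMr //; apply: le_trans h _.
by rewrite gerBl exprn_ge0.
Qed.

(** Taking differences makes the partial sums at x = 1 equal to the truncated sums, as Abel's
    theorem requires, and gives 1, 0, 0, ... for the empty index. *)
Definition coef (l : eindex) (n : nat) : R :=
  if n is m.+1 then trunc_zeta l m.+1 - trunc_zeta l m else trunc_zeta l 0.

Definition ser (e : bool) (l : eindex) (n : nat) : R := sgn e ^+ n * coef l n.

(* [sgn e] is the letter preceding the word of [l], as in [word_aux (sgn e) l]. *)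
Definition Li (e : bool) (l : eindex) (x : R) : R := PSeries (ser e l) x.

Lemma coef_cons s b l n : coef ((s, b) :: l) n.+1 = term s b n.+1 * trunc_zeta l n.
Proof. by rewrite /coef trunc_zetaS addrC addKr. Qed.

Lemma ser_cons e s b l n :
  ser e ((s, b) :: l) n.+1 = sgn (e (+) b) ^+ n.+1 / n.+1%:R ^+ s * trunc_zeta l n.
Proof. by rewrite /ser coef_cons /term !mulrA sgn_addb exprMn. Qed.

Lemma ser_cons0 e s b l : ser e ((s, b) :: l) 0 = 0.
Proof. exact: mulr0. Qed.

Lemma trunc_zeta_growth l : admissible l ->
  exists C : R, forall n, `|trunc_zeta l n| <= C * n.+1%:R.
Proof.
move=> /asym_trunc_zeta[P /(asym_slow harm_ge0_on) sl _].
have [C hC] := rapidM harm_ge0_on sl rapid_inv 0; exists C => n.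
have := hC n I; rewrite expr0 mulr1 normrM [`|_^-1|]ger0_norm ?invr_ge0 //.
by rewrite ler_pdivrMr ?ltr0n.
Qed.

Lemma ser_growth e l : admissible l -> exists C : R, forall n, `|ser e l n| <= C * n.+1%:R.
Proof.
move=> /trunc_zeta_growth[C hC]; exists (2 * C) => -[|n].
  rewrite /ser normrM normr_sgnX mul1r; apply: le_trans (hC 0) _.
  by have := le_trans (normr_ge0 _) (hC 0); rewrite !mulr1; lra.
rewrite /ser normrM normr_sgnX mul1r; apply: le_trans (ler_normB _ _) _.
have h1 := hC n.+1; have h2 := hC n.
have C0 : 0 <= C by have := le_trans (normr_ge0 _) (hC 0); rewrite mulr1.
have : C * n.+1%:R <= C * n.+2%:R by rewrite ler_wpM2l // ler_nat.
lra.
Qed.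

Lemma CV_ser e l x : admissible l -> `|x| < 1 -> Rbar_lt (Rabs x) (CV_radius (ser e l)).
Proof. by move=> /(ser_growth e)[C hC]; apply: CV_radius_gt hC. Qed.

Definition dLi e l (x : R) : R := PSeries (PS_derive (ser e l)) x.

Lemma is_derive_Li e l x : admissible l -> `|x| < 1 -> is_derive (Li e l) x (dLi e l x).
Proof. by move=> hl hx; apply: is_derive_PSeries; apply: CV_ser. Qed.

Lemma continuous_dLi e l x : admissible l -> `|x| < 1 -> continuity_pt (dLi e l) x.
Proof.
by move=> hl hx; apply: PSeries_continuity; rewrite CV_radius_derive; apply: CV_ser.
Qed.

Lemma Li_cons0 e s b l : Li e ((s, b) :: l) 0 = 0.
Proof. by rewrite /Li PSeries_0 ser_cons0. Qed.

Lemma Li_nil e x : `|x| < 1 -> Li e [::] x = 1.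
Proof.
move=> hx; rewrite /Li PSeries_decr_1; last exact/CV_radius_inside/CV_ser.
rewrite (PSeries_ext _ (fun=> 0%R)).
  by rewrite PSeries_const_0 RplusE RmultE mulr0 addr0 /ser mul1r.
by move=> n; rewrite /PS_decr_1 /ser /coef subrr mulr0.
Qed.

Lemma Li_cons_addb e s b l x : Li e ((s, b) :: l) x = Li false ((s, e (+) b) :: l) x.
Proof.
by apply: PSeries_ext => -[|n]; rewrite ?ser_cons0 // !ser_cons addFb.
Qed.

Lemma mul_dLi_S e s b l x : x * dLi e ((s.+1, b) :: l) x = Li e ((s, b) :: l) x.
Proof.
rewrite /dLi -RmultE -PSeries_incr_1; apply: PSeries_ext => -[|n].
  by rewrite ser_cons0.
rewrite /PS_incr_1 /PS_derive !ser_cons INRE RmultE [_ ^+ s.+1]exprS.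
have : n.+1%:R != 0 :> R by rewrite pnatr_eq0.
have : n.+1%:R ^+ s != 0 :> R by rewrite expf_neq0 // pnatr_eq0.
by move: (n.+1%:R ^+ s) => y; move: n.+1%:R => N y0 N0; field; rewrite y0 N0.
Qed.

(** The derivative has coefficients a^(n+1) times truncated sums of l; since a^2 = 1, multiplying by
    a - x takes their differences, which are the coefficients of the tail. *)
Lemma mul_dLi_1 e b l x : admissible l -> `|x| < 1 ->
  (sgn (e (+) b) - x) * dLi e ((1%N, b) :: l) x = Li (e (+) b) l x.
Proof.
move=> hl hx; set a := sgn (e (+) b).
pose d n : R := a ^+ n.+1 * trunc_zeta l n.
have dE n : PS_derive (ser e ((1%N, b) :: l)) n = d n.
  rewrite /PS_derive ser_cons INRE RmultE expr1 -/a /d.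
  by rewrite mulrA mulrCA divff ?mulr1 // pnatr_eq0.
have CVd : ex_pseries d x.
  have [C hC] := trunc_zeta_growth hl.
  apply: CV_radius_inside; apply: (CV_radius_gt (C := C)) hx => n.
  by rewrite /d normrM normr_sgnX mul1r.
rewrite /dLi (PSeries_ext _ _ _ dE) mulrBl.
rewrite -[a * _]RmultE -[x * _]RmultE -PSeries_scal -PSeries_incr_1.
rewrite -RminusE -PSeries_minus; last 2 first.
- by apply: ex_pseries_scal => //; apply: Rmult_comm.
- exact: ex_pseries_incr_1.
have aa : a * a = 1 by apply: sgn_sqr.
apply: PSeries_ext => -[|n].
  rewrite -[LHS]/(a * (a ^+ 1 * trunc_zeta l 0) - 0) subr0 expr1 mulrA aa.
  by rewrite /ser expr0.
rewrite -[LHS]/(a * (a ^+ n.+2 * trunc_zeta l n.+1) - a ^+ n.+1 * trunc_zeta l n).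
by rewrite mulrA !exprS mulrA aa mul1r /ser /coef mulrBr exprS.
Qed.

Lemma lt1_norm (x : R) : 0 <= x -> x < 1 -> `|x| < 1.
Proof. by move=> x0 x1; rewrite ger0_norm. Qed.

Lemma sgn_sub_neq0 e (x : R) : 0 <= x -> x < 1 -> sgn e - x != 0.
Proof.
move=> x0 x1; rewrite sgnE; case: e; rewrite ?expr1 ?expr0.
  by rewrite lt_eqF //; lra.
by rewrite gt_eqF //; lra.
Qed.

Lemma RInt_dLi e l x : admissible l -> 0 <= x -> x < 1 ->
  RInt (dLi e l) 0 x = Li e l x - Li e l 0.
Proof.
move=> hl x0 x1; apply: is_RInt_unique.
have bnd (y : R) : Rle (Rmin 0 x) y /\ Rle y (Rmax 0 x) -> `|y| < 1.
  rewrite Rmin_left; last exact/RleP.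
  rewrite Rmax_right; last exact/RleP.
  move=> [/RleP y0 /RleP yx]; apply: lt1_norm => //; exact: le_lt_trans x1.
apply: (is_RInt_derive (Li e l)) => y /bnd hy; first exact: is_derive_Li.
by apply/continuity_pt_filterlim; apply: continuous_dLi.
Qed.

(** For a nonempty word both sides vanish at 0 and have the same derivative on the open interval,
    away from the pole of dt/t. The product of signs accumulated in [word_aux] becomes an exclusive
    or. *)
Lemma iter_intE e l x : admissible l -> 0 <= x -> x < 1 ->
  iter_int (word_aux (sgn e) l) x = Li e l x.
Proof.
elim: l e x => [|[s b] l IH] e x.
  by move=> _ x0 x1; rewrite Li_nil // lt1_norm.
move=> /= /andP[s0 hl]; case: s s0 => // s _; rewrite subn1 /=.
have hs k : admissible ((k.+1, b) :: l) by [].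
have -> : Rmult (sgn e) (sgn b) = sgn (e (+) b) by rewrite sgn_addb.
elim: s x => [|s IHs] x x0 x1 /=.
  rewrite -[RHS]subr0 -(Li_cons0 e 1 b l) -RInt_dLi //; apply: RInt_ext => t.
  rewrite Rmin_left; last exact/RleP.
  rewrite Rmax_right; last exact/RleP.
  move=> [/RltP t0 /RltP tx].
  have t1 : t < 1 by apply: lt_trans x1.
  rewrite IH ?(ltW t0) // -mul_dLi_1 // ?lt1_norm ?(ltW t0) //.
  by rewrite RmultE RinvE RminusE mulrA mulVf ?mul1r // sgn_sub_neq0 // ltW.
rewrite -[RHS]subr0 -(Li_cons0 e s.+2 b l) -RInt_dLi //; apply: RInt_ext => t.
rewrite Rmin_left; last exact/RleP.
  rewrite Rmax_right; last exact/RleP.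
move=> [/RltP t0 /RltP tx].
have t1 : t < 1 by apply: lt_trans x1.
rewrite IHs ?(ltW t0) // -mul_dLi_S.
by rewrite RmultE RinvE mulrA mulVf ?mul1r // gt_eqF.
Qed.

(** * Expansions of iterated integrals at 1 *)

Definition unit_dom (x : R) : Prop := 0 <= x < 1.

Definition Lg (x : R) : R := - ln (1 - x).

Lemma Lg_ge0 x : unit_dom x -> 0 <= Lg x.
Proof.
move=> /andP[x0 x1]; have : 0 < 1 - x by lra.
by move/ln_le_sub1; rewrite /Lg; lra.
Qed.

Lemma exp_Lg x : unit_dom x -> exp (Lg x) = (1 - x)^-1.
Proof.
move=> /andP[x0 x1]; have x2 : 0 < 1 - x by lra.
by rewrite /Lg -lnV // exp_ln //; apply/RltP; rewrite invr_gt0.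
Qed.

Lemma le_Lg x y : unit_dom x -> unit_dom y -> Lg x <= Lg y -> x <= y.
Proof.
move=> Dx Dy h; have {h} : exp (Lg x) <= exp (Lg y).
  move: h; rewrite le_eqVlt => /orP[/eqP -> //|/RltP/exp_increasing/RltP/ltW //].
case/andP: (Dx) (Dy) => x0 x1 /andP[y0 y1].
by rewrite !exp_Lg // lef_pV2 ?posrE; lra.
Qed.

Lemma rapid_1sub : rapid unit_dom Lg (fun x => 1 - x).
Proof.
move=> k; have [C C0 hC] := exp_ge_power k; exists C => x Dx.
have := hC _ (Lg_ge0 Dx); rewrite exp_Lg //; case/andP: Dx => x0 x1.
have x2 : 0 < 1 - x by lra.
by rewrite ler_pdivlMr // => h; rewrite ger0_norm ?(ltW x2) // mulrC.
Qed.

Definition near1 (n : nat) : R := 1 - exp (- n%:R).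

Lemma unit_dom_near1 n : unit_dom (near1 n).
Proof.
have : 0 < exp (- n%:R) by apply/RltP/exp_pos.
suff : exp (- n%:R) <= 1 by rewrite /unit_dom /near1; move=> *; apply/andP; lra.
have /RleP := exp_ineq1_le n%:R; rewrite RplusE => h.
have e : exp n%:R * exp (- n%:R) = 1 by rewrite expRD RplusE subrr expR0.
have p : 0 < exp (- n%:R) by apply/RltP/exp_pos.
rewrite -[X in _ <= X]e ler_peMl ?(ltW p) //; apply: le_trans h; by rewrite lerDl.
Qed.

Lemma Lg_near1 n : Lg (near1 n) = n%:R.
Proof. by rewrite /Lg /near1 opprB addrCA subrr addr0 ln_exp opprK. Qed.

Lemma Lg_near1_unbounded (B : R) : exists N, forall n, (N <= n)%N -> B <= Lg (near1 n).
Proof.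
exists (Num.bound `|B|) => n hn; rewrite Lg_near1.
apply: le_trans (ler_norm B) _; apply: le_trans (ltW (archi_boundP (normr_ge0 B))) _.
by rewrite ler_nat.
Qed.

Lemma is_derive_Lg x : unit_dom x -> is_derive Lg x (1 - x)^-1.
Proof.
move=> /andP[x0 x1]; have x2 : 0 < 1 - x by rewrite subr_gt0.
apply: (is_derive_ext (fun t => Ropp (ln (Rminus (IZR 1) t)))) => //.
auto_derive; first exact/RltP.
by rewrite !RealsE mulN1r opprK.
Qed.

Lemma is_derive_horner (P : {poly R}) (f : R -> R) x (df : R) : is_derive f x df ->
  is_derive (fun t => P.[f t]) x (P^`().[f x] * df).
Proof.
move=> hf; elim/poly_ind: P => [|P c IH].
  rewrite deriv0 horner0 mul0r.
  apply: (is_derive_ext (fun _ : R => (0 : R))); last exact: is_derive_const.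
  by move=> t; rewrite horner0.
apply: (is_derive_ext (fun t => P.[f t] * f t + c)); first by move=> t; rewrite hornerMXaddC.
have h := is_derive_mult _ _ _ _ _ IH hf Rmult_comm.
have := is_derive_plus _ _ _ _ _ h (is_derive_const c x).
rewrite derivD derivC addr0 derivM derivX mulr1 hornerD hornerMX.
congr is_derive; rewrite /plus /mult /zero /=.
rewrite !RealsE; ring.
Qed.

Lemma ge0_derive_le (F dF : R -> R) (a b : R) : a <= b ->
  (forall x, a <= x <= b -> is_derive F x (dF x)) ->
  (forall x, a <= x <= b -> 0 <= dF x) -> F a <= F b.
Proof.
move=> ab hF dF0; have ab' : Rle a b by apply/RleP.
have [] := MVT_gen F a b dF; rewrite ?Rmin_left ?Rmax_right //.
- move=> x [/RltP ax /RltP xb]; apply: hF; by rewrite !ltW.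
- move=> x [/RleP ax /RleP xb]; apply/derivable_continuous_pt.
  by exists (dF x); apply/is_derive_Reals/hF/andP.
move=> c [[/RleP ac /RleP cb]]; rewrite RmultE !RminusE => e.
by rewrite -subr_ge0 e mulr_ge0 ?subr_ge0 // dF0 // ac cb.
Qed.

(** The majorant replacing the telescoping sum is -(1 + Lg)^-(k+1), whose derivative (k+1) (1 +
    Lg)^-(k+2) / (1 - x) dominates |F'| up to C. *)
Lemma rapid_int_tail (F dF : R -> R) :
  (forall x, unit_dom x -> is_derive F x (dF x)) ->
  rapid unit_dom Lg (fun x => dF x * (1 - x)) -> exists c : R, asym unit_dom Lg F c%:P.
Proof.
move=> hF h; apply: (rapid_tail Lg_ge0 unit_dom_near1 Lg_near1_unbounded) => k.
have [C hC] := h k.+2; exists C => x y Dx Dy /(le_Lg Dx Dy) xy.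
have L1 z : unit_dom z -> 1 <= 1 + Lg z by move/Lg_ge0; lra.
have C0 : 0 <= C.
  by apply: le_trans (hC x Dx); rewrite mulr_ge0 ?exprn_ge0 // addr_ge0 ?Lg_ge0.
have Dxy z : x <= z <= y -> unit_dom z.
  move=> /andP[xz zy]; case/andP: Dx => x0 _; case/andP: Dy => _ y1.
  by apply/andP; split; [apply: le_trans xz|apply: le_lt_trans y1].
pose phi z : R := - (1 + Lg z)^-1 ^+ k.+1.
pose dphi z : R := k.+1%:R * (1 + Lg z)^-1 ^+ k.+2 * (1 - z)^-1.
have hphi z : unit_dom z -> is_derive phi z (dphi z).
  move=> Dz.
  have h1 : is_derive (fun z => 1 + Lg z) z (1 - z)^-1.
    have := is_derive_plus _ _ _ _ _ (is_derive_const (1 : R) z) (is_derive_Lg Dz).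
    by rewrite /plus /zero /= Rplus_0_l.
  have n0 : 1 + Lg z <> 0 by apply/eqP; rewrite gt_eqF //; have := L1 _ Dz; lra.
  have hd := is_derive_opp _ _ _ (is_derive_pow _ k.+1 _ _ (is_derive_inv _ _ _ h1 n0)).
  apply: (is_derive_ext (fun t : R => Ropp (pow (Rinv (1 + Lg t)) k.+1))).
    by move=> t; rewrite RpowE.
  move: hd; congr is_derive.
  rewrite -[LHS]/(Ropp (Rmult (Rmult (INR k.+1)
    (Rdiv (Ropp (1 - z)^-1) (pow (1 + Lg z) 2))) (pow (Rinv (1 + Lg z)) k))).
  by rewrite !RealsE /dphi -exprVn !exprS expr0; ring.
have bnd z : unit_dom z -> `|dF z| <= C * dphi z.
  move=> Dz; have Y1 := L1 _ Dz; have := hC z Dz; case/andP: (Dz) => z0 z1.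
  have z2 : 0 < 1 - z by lra.
  have Y0 : 0 < (1 + Lg z) ^+ k.+2 by rewrite exprn_gt0 //; lra.
  rewrite normrM (ger0_norm (ltW z2)) -ler_pdivlMr // -ler_pdivlMr // => h1.
  apply: le_trans h1 _; rewrite /dphi exprVn -mulrA ler_wpM2l // -mulrA ler_peMl ?ler1n //.
  by rewrite mulr_ge0 ?invr_ge0 ?(ltW Y0) ?(ltW z2).
have dC z (s : R) : unit_dom z ->
    is_derive (fun t => C * phi t + s * F t) z (C * dphi z + s * dF z).
  move=> Dz.
  have h1 := is_derive_scal phi z C _ (hphi z Dz).
  have h2 := is_derive_scal F z s _ (hF z Dz).
  exact: (is_derive_plus _ _ _ _ _ h1 h2).
(* The choices s = 1 and s = -1 give the two halves of the bound on F y - F x. *)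
have mono (s : R) : `|s| = 1 -> C * phi x + s * F x <= C * phi y + s * F y.
  move=> s1; apply: (@ge0_derive_le (fun t => C * phi t + s * F t)
    (fun z => C * dphi z + s * dF z)) => // z /Dxy Dz; first exact: dC.
  have : `|s * dF z| <= C * dphi z by rewrite normrM s1 mul1r bnd.
  by rewrite ler_norml => /andP[h1 _]; lra.
have m1 := mono 1 (normr1 _); have m2 := mono (-1) (normrN1 _).
have Y0 : 0 < 1 + Lg x by have := L1 _ Dx; lra.
have phy : phi y <= 0 by rewrite oppr_le0 exprn_ge0 // invr_ge0; have := L1 _ Dy; lra.
have h1 : `|F y - F x| <= C * (- phi x).
  have : C * phi y <= 0 by rewrite mulr_ge0_le0.
  by rewrite ler_norml => *; apply/andP; split; lra.
apply: le_trans (ler_wpM2r _ h1) _; first by rewrite exprn_ge0 // ltW.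
rewrite -mulrA ler_piMr // /phi opprK exprVn -ler_pdivlMr ?exprn_gt0 // mul1r.
by rewrite lef_pV2 ?posrE ?exprn_gt0 // ler_weXn2l // L1.
Qed.

Lemma asym_int (F dF V dV : R -> R) Q :
  (forall x, unit_dom x -> is_derive F x (dF x)) ->
  (forall x, unit_dom x -> is_derive V x (dV x)) -> asym unit_dom Lg V Q ->
  rapid unit_dom Lg (fun x => (dF x - dV x) * (1 - x)) ->
  exists c : R, asym unit_dom Lg F (Q + c%:P).
Proof.
move=> hF hV aV h; have [|//|c hc] := @rapid_int_tail (fun x => F x - V x) (fun x => dF x - dV x).
  move=> x Dx; exact: (is_derive_minus _ _ _ _ _ (hF x Dx) (hV x Dx)).
by exists c; apply: eq_asym (asymD Lg_ge0 aV hc) => x _; rewrite addrC subrK.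
Qed.

Lemma unit_dom_norm x : unit_dom x -> `|x| < 1.
Proof. by move=> /andP[x0 x1]; rewrite ger0_norm. Qed.

(** The quotient Li/x is singular at 0 only in appearance: on [0, 1/2] the derivative is continuous,
    hence bounded by B, and beyond 1/2 dividing by x costs a factor 2. *)
Lemma slow_dLi e s b l P : (0 < s)%N -> admissible l ->
  asym unit_dom Lg (Li e ((s, b) :: l)) P -> slow unit_dom Lg (dLi e ((s.+1, b) :: l)).
Proof.
move=> s0 hl /(asym_slow Lg_ge0)[k [C hC]].
have hl' : admissible ((s.+1, b) :: l) by [].
have [||m [hm _]] := continuity_ab_maj (fun x => Rabs (dLi e ((s.+1, b) :: l) x)) 0 2^-1.
- by apply/RleP; rewrite invr_ge0.
- move=> c [/RleP c0 /RleP c1]; apply: (continuity_pt_comp _ Rabs); last exact: Rcontinuity_abs.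
  by apply: continuous_dLi => //; rewrite ger0_norm //; lra.
set B := Rabs _ in hm; have B0 : 0 <= B by apply/RleP/Rabs_pos.
exists k, (B + 2 * C) => x Dx; case/andP: (Dx) => x0 x1.
have L1 : 1 <= (1 + Lg x) ^+ k by rewrite exprn_ege1 //; have := Lg_ge0 Dx; lra.
have C0 : 0 <= C * (1 + Lg x) ^+ k by apply: le_trans (hC x Dx).
have BB : 0 <= B * ((1 + Lg x) ^+ k - 1) by rewrite mulr_ge0 // subr_ge0.
rewrite mulrDl; have [xh|xh] := leP x 2^-1.
  have /RleP := hm x (conj (RleP x0) (RleP xh)); rewrite RabsE; lra.
have := hC x Dx; rewrite -mul_dLi_S normrM (ger0_norm x0).
have := normr_ge0 (dLi e ((s.+1, b) :: l) x); move: `|dLi _ _ _| => y y0 h.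
have : 0 <= (x - 2^-1) * y by rewrite mulr_ge0 // subr_ge0 ltW.
lra.
Qed.

(** For a first letter dt/t or dt/(-1 - t) the derivative is slow, so its product with 1 - x is
    rapid and only a constant arises. For dt/(1 - t) the comparison function is Q(Lg) with Q' =
    P. *)
Lemma asym_Li e l : admissible l -> exists Q, asym unit_dom Lg (Li e l) Q.
Proof.
elim: l e => [|[s b] l IH] e.
  move=> _; exists 1%:P; apply: eq_asym (asymC _ _ 1) => x Dx.
  by rewrite Li_nil // unit_dom_norm.
move=> /= /andP[s0 hl]; have hs k : admissible ((k.+1, b) :: l) by [].
have dL k x : unit_dom x -> is_derive (Li e ((k.+1, b) :: l)) x (dLi e ((k.+1, b) :: l) x).
  by move=> Dx; apply: is_derive_Li => //; apply: unit_dom_norm.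
case: s s0 => // s _; elim: s => [|s [Q hQ]]; last first.
  have [|||c hc] := @asym_int _ _ (fun=> 0) (fun=> 0) 0 (dL s.+1).
  - by move=> x _; apply: is_derive_const.
  - exact: asymC.
  - have := rapidM Lg_ge0 (slow_dLi (ltn0Sn s) hl hQ) rapid_1sub.
    by apply: eq_rapid => x _; rewrite subr0.
  - by exists (0 + c%:P).
have [P hP] := IH (e (+) b) hl.
have dE x : unit_dom x -> dLi e ((1%N, b) :: l) x = (sgn (e (+) b) - x)^-1 * Li (e (+) b) l x.
  move=> Dx; rewrite -(@mul_dLi_1 e b l x hl (unit_dom_norm Dx)) mulKf //.
  by case/andP: Dx => x0 x1; apply: sgn_sub_neq0.
case: (e (+) b) hP dE => hP dE.
  have [|||c hc] := @asym_int _ _ (fun=> 0) (fun=> 0) 0 (dL 0).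
  - by move=> x _; apply: is_derive_const.
  - exact: asymC.
  - have sl : slow unit_dom Lg (fun x => (sgn true - x)^-1).
      exists 0, 1 => x /andP[x0 x1]; rewrite expr0 mulr1 sgnE expr1 -opprD invrN normrN.
      rewrite ger0_norm ?invr_ge0 ?invf_le1; lra.
    have := rapidM Lg_ge0 (slowM sl (asym_slow Lg_ge0 hP)) rapid_1sub.
    by apply: eq_rapid => x Dx; rewrite subr0 dE.
  - by exists (0 + c%:P).
have [Q QP] := poly_antideriv P.
have [|||c hc] := @asym_int _ _ (fun x => Q.[Lg x]) (fun x => P.[Lg x] * (1 - x)^-1) Q (dL 0).
- by move=> x Dx; rewrite -QP; apply/is_derive_horner/is_derive_Lg.
- exact: asym_horner.
- apply: eq_rapid hP => x Dx; rewrite dE // sgnE expr0.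
  have x1 : 1 - x != 0 by case/andP: Dx => x0 x1; rewrite subr_eq0 gt_eqF.
  by field.
- by exists (Q + c%:P).
Qed.

Lemma unit_dom_vanishingP (f : R -> R) :
  vanishing unit_dom Lg f <->
  forall e, 0 < e -> exists2 d, 0 < d & forall t, 0 < t -> t < d -> t <= 1 -> `|f (1 - t)| < e.
Proof.
split=> h e /h.
  move=> [B hB]; exists (exp (- B)); first exact/RltP/exp_pos.
  move=> t t0 td t1; have Dt : unit_dom (1 - t) by apply/andP; split; lra.
  apply: hB => //; rewrite /Lg subKr lerNr.
  by rewrite -(ln_exp (- B)); apply/RleP/Rlt_le/ln_increasing; apply/RltP.
(* The threshold 1/d works because Lg x < exp (Lg x) = 1/(1 - x). *)
move=> [d d0 hd]; exists d^-1 => x Dx hx; rewrite -(subKr 1 x).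
have x2 : 0 < 1 - x by case/andP: Dx; lra.
apply: hd => //; last by case/andP: Dx; lra.
rewrite -[X in _ < X]invrK -[X in X < _]invrK ltf_pV2 ?posrE ?invr_gt0 //.
rewrite -exp_Lg //; apply: le_lt_trans hx _.
have /RleP := exp_ineq1_le (Lg x); rewrite RplusE; apply: lt_le_trans.
by rewrite ltrDr.
Qed.

Lemma ballE (x : R) (d : posreal) (t : R) : ball x d t <-> `|t - x| < pos d.
Proof. by rewrite -[ball _ _ _]/(Rlt (Rabs (Rplus t (Ropp x))) d) RabsE; split=> /RltP. Qed.

Lemma ball0E (d : posreal) (t : R) : ball (0 : R) d t <-> `|t| < pos d.
Proof. by rewrite ballE subr0. Qed.

Lemma vanishing_at_right (f : R -> R) :
  vanishing unit_dom Lg f <->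
  filterlim (fun t => f (1 - t)) (at_right 0) (locally (0 : R)).
Proof.
rewrite unit_dom_vanishingP filterlim_locally; split=> [h [e e0]|h e e0].
  have [|d d0 hd] := h e; first exact/RltP.
  have d1 : 0 < Num.min d 1 by rewrite lt_min d0 ltr01.
  exists (mkposreal _ (RltP d1)) => t /ball0E /= ht /RltP t0.
  apply: (iffRL (ball0E (mkposreal e e0) _)) => /=.
  by move: ht; rewrite gtr0_norm // lt_min => /andP[td t1]; rewrite hd // ltW.
have [[d d0] hd] := h (mkposreal e (RltP e0)).
exists d => [|t t0 td _]; first exact/RltP.
have bt : ball (0 : R) (mkposreal d d0) t by apply: (iffRL (ball0E _ _)); rewrite gtr0_norm.
exact: (iffLR (ball0E (mkposreal e (RltP e0)) _) (hd t bt (RltP t0))).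
Qed.

Lemma is_zeta_shE l P Q : admissible l -> asym unit_dom Lg (Li false l) P ->
  is_zeta_sh l Q <-> P = Q.
Proof.
move=> hl hP.
have aw : asym unit_dom Lg (iter_int (eword l)) P.
  by apply: eq_asym hP => x /andP[x0 x1]; rewrite -(iter_intE false).
have E (S : {poly R}) : is_zeta_sh l S <->
    vanishing unit_dom Lg (fun x => iter_int (eword l) x - S.[Lg x]).
  rewrite vanishing_at_right; rewrite /is_zeta_sh.
  by split; apply: filterlim_ext => t; rewrite /Lg subKr.
rewrite E; split=> [h|<-]; last exact: (rapid_vanishing Lg_ge0 aw).
apply: (asym_unique Lg_ge0 unit_dom_near1 Lg_near1_unbounded) aw (asym_horner _ _ Q) h.
Qed.

Lemma zeta_sh_asym l : admissible l -> asym unit_dom Lg (Li false l) (zeta_sh l).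
Proof.
move=> hl; have [P hP] := asym_Li false hl.
have h : exists Q, is_zeta_sh l Q by exists P; apply/(is_zeta_shE _ hl hP).
suff <- : P = zeta_sh l by [].
exact: (iffLR (is_zeta_shE _ hl hP) (epsilon_spec (inhabits 0%R) _ h)).
Qed.

(** * Abel's theorem for convergent indices *)

Lemma sum_coef l n : sum_n (coef l) n = trunc_zeta l n.
Proof.
elim: n => [|n IH]; first by rewrite sum_O.
by rewrite sum_Sn IH /plus /= RplusE addrC subrK.
Qed.

Lemma Li_vanishing l : admissible l -> convergent l ->
  vanishing unit_dom Lg (fun x => Li false l x - zeta l).
Proof.
move=> hl cl.
have hs : is_series (coef l) (zeta l).
  have := asym_is_lim_seq (zeta_asym hl cl).
  by apply: filterlim_ext => n; rewrite sum_coef.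
have serE n : ser false l n = coef l n by rewrite /ser sgnE expr0 expr1n mul1r.
have ps : is_pseries (ser false l) 1 (zeta l).
  apply: is_series_ext hs => n.
  by rewrite serE pow_n_pow /scal /= /mult /= RpowE expr1n RmultE mul1r.
have lim : filterlim (Li false l) (at_left 1) (locally (zeta l)).
  have e1 : PSeries (ser false l) 1 = zeta l by apply: is_pseries_unique.
  have cv := CV_ser false hl.
  have cont : Rbar_lt (Rabs 1) (CV_radius (ser false l)) ->
      filterlim (Li false l) (at_left 1) (locally (zeta l)).
    move=> /PSeries_continuity/continuity_pt_filterlim; rewrite e1 => h P /h.
    by move=> [d hd]; exists d => y hy _; apply: hd.
  (* Abel's theorem is applied at radius exactly 1. A larger radius, infinite for the empty index,
     gives continuity at 1; a smaller one contradicts [CV_ser]. *)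
  have := @Abel (ser false l).
  case E : (CV_radius (ser false l)) cv cont => [r| |] cv cont ab.
  - have [r1|r1|r1] := ltgtP r 1.
    + have : `|Num.max r 0| < 1 by rewrite ger0_norm ?le_max ?lexx ?orbT // gt_max r1 ltr01.
      move/cv => /RltP; rewrite RabsE ger0_norm ?le_max ?lexx ?orbT //.
      by rewrite gt_max ltxx.
    + by apply: cont; rewrite /= Rabs_R1; apply/RltP.
    + rewrite -e1; move: ab; rewrite r1 /=; apply => //; first exact/RltP.
      by exists (zeta l).
  - exact: cont.
  - by have := cv 0; rewrite normr0 => /(_ ltr01).
apply/unit_dom_vanishingP => e e0.
have [[d d0] hd] := iffLR (filterlim_locally _ _) lim (mkposreal e (RltP e0)).
exists d => [|t t0 td _]; first exact/RltP.
have bt : ball (1 : R) (mkposreal d d0) (1 - t).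
  by apply: (iffRL (ballE _ _ _)); rewrite addrAC subrr add0r normrN gtr0_norm.
have t1 : Rlt (1 - t) 1 by apply/RltP; rewrite gtrBl.
exact: (iffLR (ballE _ (mkposreal e (RltP e0)) _) (hd _ bt t1)).
Qed.

Lemma Li_asym_zeta l : admissible l -> convergent l ->
  asym unit_dom Lg (Li false l) (zetaP l).
Proof.
move=> hl cl; have h := Li_vanishing hl cl.
suff -> : zetaP l = zeta_sh l by apply: zeta_sh_asym.
apply: esym.
exact: (asym_unique Lg_ge0 unit_dom_near1 Lg_near1_unbounded (zeta_sh_asym hl) (asymC _ _ _) h).
Qed.

(** * The shuffle product *)

Lemma is_derive_eq (f : R -> R) (x d d' : R) : is_derive f x d -> d = d' -> is_derive f x d'.
Proof. by move=> h <-. Qed.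

Lemma is_derive_mulr (f g : R -> R) (x df dg : R) : is_derive f x df -> is_derive g x dg ->
  is_derive (fun t => f t * g t) x (df * g x + f x * dg).
Proof. by move=> hf hg; apply: (is_derive_mult _ _ _ _ _ hf hg Rmult_comm). Qed.

Lemma is_derive_sumr (I : eqType) (r : seq I) (f : I -> R -> R) (x : R) (df : I -> R) :
  (forall i, i \in r -> is_derive (f i) x (df i)) ->
  is_derive (fun t => \sum_(i <- r) f i t) x (\sum_(i <- r) df i).
Proof.
elim: r => [|i r IH] h.
  rewrite big_nil; apply: (is_derive_ext (fun _ : R => (0 : R))); last exact: is_derive_const.
  by move=> t; rewrite big_nil.
rewrite big_cons; apply: (is_derive_ext (fun t => f i t + \sum_(i <- r) f i t)).
  by move=> t; rewrite big_cons.
apply: (is_derive_plus (f i)); first exact/h/mem_head.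
by apply: IH => j jr; apply: h; rewrite inE jr orbT.
Qed.

Lemma is_derive_comp2 w (f : nat -> nat -> R -> R) (x : R) (df : nat -> nat -> R) :
  (forall s t, (0 < s)%N -> (0 < t)%N -> is_derive (f s t) x (df s t)) ->
  is_derive (fun y => comp2 w (fun s t => f s t y)) x (comp2 w df).
Proof.
move=> h; apply: is_derive_sumr => s; rewrite mem_index_iota => /andP[s0 sw].
by apply: h => //; rewrite subn_gt0.
Qed.

Lemma is_derive_comp3 w (f : nat -> nat -> nat -> R -> R) (x : R) (df : nat -> nat -> nat -> R) :
  (forall s t r, (0 < s)%N -> (0 < t)%N -> (0 < r)%N -> is_derive (f s t r) x (df s t r)) ->
  is_derive (fun y => comp3 w (fun s t r => f s t r y)) x (comp3 w df).
Proof.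
move=> h; apply: is_derive_sumr => s; rewrite mem_index_iota => /andP[s0 sw].
by apply: is_derive_comp2 => t r t0 r0; apply: h.
Qed.

(** The derivative is prescribed for x > 0, where the formulas with 1/x hold; at 0 differentiability
    gives the continuity that the mean value theorem asks for. *)
Lemma derive0_eq0 (F : R -> R) : F 0 = 0 ->
  (forall x, unit_dom x -> ex_derive F x) ->
  (forall x, 0 < x -> x < 1 -> is_derive F x 0) ->
  forall x, unit_dom x -> F x = 0.
Proof.
move=> F0 cF dF x /andP[x0 x1]; have x0' : Rle 0 x by apply/RleP.
have [] := MVT_gen F 0 x (fun=> 0); rewrite ?Rmin_left ?Rmax_right //.
- by move=> y [/RltP y0 /RltP yx]; apply: dF => //; apply: lt_trans x1.
- move=> y [/RleP y0 /RleP yx]; apply/derivable_continuous_pt/ex_derive_Reals_0.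
  by apply: cF; rewrite /unit_dom y0 (le_lt_trans yx).
by move=> c [_]; rewrite RminusE RmultE mul0r F0 subr0.
Qed.

(* The booleans are the letters, so the signs of the index are their successive quotients. *)
Definition Li1 a s := Li false [:: (s, a)].
Definition Li2 a b s t := Li false [:: (s, a); (t, a (+) b)].
Definition Li3 a b c s t r := Li false [:: (s, a); (t, a (+) b); (r, b (+) c)].

(** When s = 1 the letter removed is dt/(sgn b - t), and b becomes the prefix of the remaining word,
    hence [Li b l]. *)
Definition DLi s b l (x : R) : R :=
  if s is s'.+2 then x^-1 * Li false ((s'.+1, b) :: l) x
  else (sgn b - x)^-1 * Li b l x.
Arguments DLi : simpl never.

Lemma is_derive_DLi s b l x : (0 < s)%N -> admissible l -> 0 < x -> x < 1 ->
  is_derive (Li false ((s, b) :: l)) x (DLi s b l x).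
Proof.
move=> s0 hl x0 x1; have hx : `|x| < 1 by rewrite gtr0_norm.
have hsl : admissible ((s, b) :: l) by rewrite /= s0.
apply: is_derive_eq (is_derive_Li false hsl hx) _.
case: s s0 {hsl} => // -[|s] _; rewrite /DLi.
  by rewrite -(mul_dLi_1 false b hl hx) addFb mulKf // sgn_sub_neq0 // ltW.
by rewrite -mul_dLi_S mulKf // gt_eqF.
Qed.

Definition Li_prod2 w a b x := comp2 w (fun s t => Li1 a s x * Li1 b t x).
Definition Li_prod3 w a b c x := comp3 w (fun s t r => Li1 a s x * Li1 b t x * Li1 c r x).
Definition Li_wsum2 w a b x := comp2 w (fun s t => 2 ^+ s.-1 * Li2 a b s t x).
(** In the derivative of a product of three, a letter dt/t can come from any of three factors; once
    a pole has used up one factor, two are left. Hence the powers of 3 and 2. *)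
Definition Li_wsum3 w a b c x :=
  comp3 w (fun s t r => 3 ^+ s.-1 * 2 ^+ t.-1 * Li3 a b c s t r x).

Section Derivatives.
Variable x : R.
Hypotheses (x0 : 0 < x) (x1 : x < 1).

Let q (a : bool) : R := (sgn a - x)^-1.

Let hx : `|x| < 1. Proof. by rewrite gtr0_norm. Qed.

Lemma DLi_1_nil a : DLi 1 a [::] x = q a.
Proof. by rewrite /DLi Li_nil // mulr1. Qed.

Lemma comp2_DLi w a b : comp2 w.+2 (fun s t => DLi s a [::] x * Li1 b t x) =
  q a * Li1 b w.+1 x + x^-1 * Li_prod2 w.+1 a b x.
Proof.
rewrite comp2S DLi_1_nil /Li_prod2 comp2_mull; congr (_ + _).
by apply: eq_comp2 => -[//|s] t _ _ _; rewrite /DLi mulrA.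
Qed.

Definition dLi_prod2 w a b : R :=
  q a * Li1 b w.+1 x + q b * Li1 a w.+1 x + 2 * x^-1 * Li_prod2 w.+1 a b x.

Lemma Li_prod2C w a b y : Li_prod2 w a b y = Li_prod2 w b a y.
Proof. by rewrite /Li_prod2 comp2C; apply: eq_comp2 => s t *; rewrite mulrC. Qed.

Lemma is_derive_Li_prod2 w a b : is_derive (Li_prod2 w.+2 a b) x (dLi_prod2 w a b).
Proof.
have h := @is_derive_comp2 w.+2 (fun s t y => Li1 a s y * Li1 b t y) x
  (fun s t => DLi s a [::] x * Li1 b t x + Li1 a s x * DLi t b [::] x).
apply: is_derive_eq (h _) _ => [s t s0 t0|].
  by apply: is_derive_mulr; apply: is_derive_DLi.
rewrite comp2D comp2_DLi [X in _ + X]comp2C.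
rewrite (@eq_comp2 _ _ _ (fun s t => DLi s b [::] x * Li1 a t x)); last first.
  by move=> *; rewrite mulrC.
by rewrite comp2_DLi (Li_prod2C _ b a) /dLi_prod2; ring.
Qed.

Lemma is_derive_Li_wsum2 w a b :
  is_derive (Li_wsum2 w.+2 a b) x (q a * Li1 b w.+1 x + 2 * x^-1 * Li_wsum2 w.+1 a b x).
Proof.
have h := @is_derive_comp2 w.+2 (fun s t y => 2 ^+ s.-1 * Li2 a b s t y) x
  (fun s t => 2 ^+ s.-1 * DLi s a [:: (t, a (+) b)] x).
apply: is_derive_eq (h _) _ => [s t s0 t0|].
  by apply: is_derive_scal; apply: is_derive_DLi => //=; rewrite t0.
rewrite comp2S expr0 mul1r; congr (_ + _).
  (* The prefix a cancels against the sign a (+) b, leaving an index whose first letter is b. *)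
  by rewrite /DLi Li_cons_addb addKb.
rewrite /Li_wsum2 comp2_mull; apply: eq_comp2 => -[//|s] t _ _ _.
by rewrite /DLi /Li2 exprS; ring.
Qed.

Lemma is_derive_Li_wsum3 w a b c :
  is_derive (Li_wsum3 w.+2 a b c) x (q a * Li_wsum2 w.+1 b c x + 3 * x^-1 * Li_wsum3 w.+1 a b c x).
Proof.
have h := @is_derive_comp3 w.+2 (fun s t r y => 3 ^+ s.-1 * 2 ^+ t.-1 * Li3 a b c s t r y) x
  (fun s t r => 3 ^+ s.-1 * 2 ^+ t.-1 * DLi s a [:: (t, a (+) b); (r, b (+) c)] x).
apply: is_derive_eq (h _) _ => [s t r s0 t0 r0|].
  by apply: is_derive_scal; apply: is_derive_DLi => //=; rewrite t0 r0.
rewrite comp3S; congr (_ + _).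
  rewrite /Li_wsum2 comp2_mull; apply: eq_comp2 => t r *.
  by rewrite /DLi Li_cons_addb addKb expr0 /q /Li2 /=; ring.
rewrite /Li_wsum3 comp3_mull; apply: eq_comp3 => -[//|s] t r *.
by rewrite /DLi /Li3 exprS; ring.
Qed.

Lemma Li_prod3E w a b c y :
  Li_prod3 w a b c y = \sum_(1 <= s < w) Li1 a s y * Li_prod2 (w - s) b c y.
Proof.
apply: eq_bigr => s _; rewrite /Li_prod2 comp2_mull.
by apply: eq_comp2 => *; rewrite mulrA.
Qed.

Lemma is_derive_Li_prod3 w a b c : is_derive (Li_prod3 w.+2 a b c) x
  (q a * Li_prod2 w.+1 b c x + q b * Li_prod2 w.+1 a c x + q c * Li_prod2 w.+1 a b x
   + 3 * x^-1 * Li_prod3 w.+1 a b c x).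
Proof.
(* Below weight 2 [Li_prod2] is an empty sum with derivative 0; the index s = w + 1 meets this
   case. *)
pose dP j := if j is i.+2 then dLi_prod2 i b c else 0.
apply: (is_derive_ext (fun y => \sum_(1 <= s < w.+2) Li1 a s y * Li_prod2 (w.+2 - s) b c y)).
  by move=> y; rewrite Li_prod3E.
apply: is_derive_eq (is_derive_sumr (df := fun s => DLi s a [::] x * Li_prod2 (w.+2 - s) b c x
    + Li1 a s x * dP (w.+2 - s)%N) _) _.
  move=> s; rewrite mem_index_iota => /andP[s0 sw].
  apply: is_derive_mulr; first exact: is_derive_DLi.
  case E : (w.+2 - s)%N => [|[|j]]; last exact: is_derive_Li_prod2.
    by move: E; lia.
  apply: (is_derive_ext (fun _ : R => (0 : R))); last exact: is_derive_const.
  by move=> t; rewrite /Li_prod2 comp2_le1.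
rewrite big_split /= big_ltn // big_add1 /= DLi_1_nil subn1 /=.
have -> : \sum_(1 <= i < w.+1) DLi i.+1 a [::] x * Li_prod2 (w.+2 - i.+1) b c x =
    x^-1 * Li_prod3 w.+1 a b c x.
  rewrite Li_prod3E mulr_sumr; apply: eq_big_nat => -[//|s] _.
  by rewrite /DLi subSS mulrA.
rewrite big_nat_recr //= subSnn mulr0 addr0.
have -> : \sum_(1 <= s < w.+1) Li1 a s x * dP (w.+2 - s)%N =
    q b * Li_prod2 w.+1 a c x + q c * Li_prod2 w.+1 a b x + 2 * x^-1 * Li_prod3 w.+1 a b c x.
  have PE d e : Li_prod2 w.+1 d e x = \sum_(1 <= s < w.+1) Li1 d s x * Li1 e (w.+1 - s) x by [].
  rewrite Li_prod3E !PE !mulr_sumr -!big_split /=; apply: eq_big_nat => s /andP[s0 sw].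
  have -> : (w.+2 - s = (w - s).+2)%N by lia.
  have -> : (w.+1 - s = (w - s).+1)%N by lia.
  by rewrite /dP /dLi_prod2 /=; ring.
by ring.
Qed.

End Derivatives.

Lemma Li1_at0 a s : Li1 a s 0 = 0. Proof. exact: Li_cons0. Qed.

Lemma comp2_eq0 w (f : nat -> nat -> R) : (forall s t, f s t = 0) -> comp2 w f = 0.
Proof. by move=> h; apply: big1 => s _; apply: h. Qed.

Lemma comp3_eq0 w (f : nat -> nat -> nat -> R) : (forall s t r, f s t r = 0) -> comp3 w f = 0.
Proof. by move=> h; apply: big1 => s _; apply: comp2_eq0. Qed.

Lemma is_derive_Li1 a s x : (0 < s)%N -> unit_dom x ->
  is_derive (Li1 a s) x (dLi false [:: (s, a)] x).
Proof.
by move=> s0 Dx; apply: is_derive_Li; [rewrite /= s0|apply: unit_dom_norm].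
Qed.

Lemma ex_derive_Li_prod2 w a b x : unit_dom x -> ex_derive (Li_prod2 w a b) x.
Proof.
move=> Dx; eexists; apply: is_derive_comp2 => s t s0 t0.
by apply: is_derive_mulr; apply: is_derive_Li1.
Qed.

Lemma ex_derive_Li_prod3 w a b c x : unit_dom x -> ex_derive (Li_prod3 w a b c) x.
Proof.
move=> Dx; eexists; apply: is_derive_comp3 => s t r s0 t0 r0.
by do 2?[apply: is_derive_mulr]; apply: is_derive_Li1.
Qed.

Lemma ex_derive_Li_wsum2 w a b x : unit_dom x -> ex_derive (Li_wsum2 w a b) x.
Proof.
move=> Dx; eexists; apply: is_derive_comp2 => s t s0 t0; apply: is_derive_scal.
by apply: is_derive_Li; [rewrite /= s0 t0|apply: unit_dom_norm].
Qed.

Lemma ex_derive_Li_wsum3 w a b c x : unit_dom x -> ex_derive (Li_wsum3 w a b c) x.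
Proof.
move=> Dx; eexists; apply: is_derive_comp3 => s t r s0 t0 r0; apply: is_derive_scal.
by apply: is_derive_Li; [rewrite /= s0 t0 r0|apply: unit_dom_norm].
Qed.

Lemma shuffle2 w a b x : unit_dom x ->
  Li_prod2 w.+1 a b x = Li_wsum2 w.+1 a b x + Li_wsum2 w.+1 b a x.
Proof.
elim: w x => [|w IH] x Dx.
  by rewrite /Li_prod2 /Li_wsum2 !comp2_le1 // addr0.
apply/eqP; rewrite -subr_eq0; apply/eqP; move: x Dx.
apply: (@derive0_eq0 (fun x => Li_prod2 w.+2 a b x - (Li_wsum2 w.+2 a b x + Li_wsum2 w.+2 b a x))).
- rewrite /Li_prod2 /Li_wsum2 !comp2_eq0 ?addr0 ?subrr // => s t; rewrite ?Li1_at0 ?mul0r //.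
  + by rewrite /Li2 Li_cons0 mulr0.
  + by rewrite /Li2 Li_cons0 mulr0.
- move=> x Dx; apply: (ex_derive_minus (Li_prod2 w.+2 a b)); first exact: ex_derive_Li_prod2.
  by apply: (ex_derive_plus (Li_wsum2 w.+2 a b)); apply: ex_derive_Li_wsum2.
move=> x x0 x1.
have h := is_derive_minus _ _ _ _ _ (is_derive_Li_prod2 x0 x1 w a b)
  (is_derive_plus _ _ _ _ _ (is_derive_Li_wsum2 x0 x1 w a b) (is_derive_Li_wsum2 x0 x1 w b a)).
apply: is_derive_eq h _; rewrite /minus /plus /Hierarchy.opp /= !RealsE /dLi_prod2.
by rewrite IH ?/unit_dom ?(ltW x0) //; ring.
Qed.

(** The derivatives of the six sums pair up by first letter; [shuffle2] turns each pair into a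
    product of two, and the induction on the weight settles the part with 3/x. *)
Lemma shuffle3 w a b c x : unit_dom x -> Li_prod3 w.+2 a b c x =
  Li_wsum3 w.+2 a b c x + Li_wsum3 w.+2 a c b x + Li_wsum3 w.+2 b a c x + Li_wsum3 w.+2 b c a x
  + Li_wsum3 w.+2 c a b x + Li_wsum3 w.+2 c b a x.
Proof.
elim: w x => [|w IH] x Dx.
  by rewrite /Li_prod3 /Li_wsum3 !comp3_2 !addr0.
apply/eqP; rewrite -subr_eq0; apply/eqP; move: x Dx.
apply: (@derive0_eq0 (fun x => Li_prod3 w.+3 a b c x
  - (Li_wsum3 w.+3 a b c x + Li_wsum3 w.+3 a c b x
  + Li_wsum3 w.+3 b a c x + Li_wsum3 w.+3 b c a x
  + Li_wsum3 w.+3 c a b x + Li_wsum3 w.+3 c b a x))).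
- rewrite /Li_prod3 /Li_wsum3 !comp3_eq0 ?addr0 ?subrr // => s t r; rewrite ?Li1_at0 ?mul0r //;
    by rewrite /Li3 Li_cons0 mulr0.
- move=> x Dx; apply: (ex_derive_minus (Li_prod3 w.+3 a b c)); first exact: ex_derive_Li_prod3.
  by do 5?[apply: ex_derive_plus]; apply: ex_derive_Li_wsum3.
move=> x x0 x1.
have h d e f := is_derive_Li_wsum3 x0 x1 w.+1 d e f.
have h' := is_derive_minus _ _ _ _ _ (is_derive_Li_prod3 x0 x1 w.+1 a b c)
  (is_derive_plus _ _ _ _ _ (is_derive_plus _ _ _ _ _ (is_derive_plus _ _ _ _ _
  (is_derive_plus _ _ _ _ _ (is_derive_plus _ _ _ _ _ (h a b c) (h a c b)) (h b a c))
    (h b c a)) (h c a b)) (h c b a)).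
apply: is_derive_eq h' _; rewrite /minus /plus /Hierarchy.opp /= !RealsE.
by rewrite IH ?shuffle2 ?/unit_dom ?(ltW x0) //; ring.
Qed.

(** * The weighted sum formulas *)

Lemma zeta_star_convergent l : admissible l -> convergent l -> zeta_star l = zetaP l.
Proof.
move=> hl cl; apply: asymN_unique (zeta_star_asym hl) (zeta_asym hl cl) _.
apply: (is_lim_seq_ext (fun=> (0 : R))); last exact: is_lim_seq_const.
by move=> n; rewrite subrr.
Qed.

Lemma asymI_unique f P Q : asym unit_dom Lg f P -> asym unit_dom Lg f Q -> P = Q.
Proof.
move=> hP hQ; apply: (asym_unique Lg_ge0 unit_dom_near1 Lg_near1_unbounded) hP hQ _.
by move=> e e0; exists 0 => x *; rewrite subrr normr0.
Qed.

Lemma zeta_sh_convergent l : admissible l -> convergent l -> zeta_sh l = zetaP l.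
Proof. by move=> hl cl; apply: asymI_unique (zeta_sh_asym hl) (Li_asym_zeta hl cl). Qed.

Lemma Li1_1 x : unit_dom x -> Li1 false 1 x = Lg x.
Proof.
move=> Dx; apply/eqP; rewrite -subr_eq0; apply/eqP; move: x Dx.
have d x : unit_dom x -> is_derive (fun x => Li1 false 1 x - Lg x) x 0.
  move=> Dx; have [x0 x1] := andP Dx.
  have h := is_derive_minus _ _ _ _ _ (is_derive_Li1 false (ltn0Sn 0) Dx) (is_derive_Lg Dx).
  apply: is_derive_eq h _; rewrite /minus /plus /Hierarchy.opp /= !RealsE.
  have := @mul_dLi_1 false false [::] x isT (unit_dom_norm Dx).
  rewrite Li_nil ?unit_dom_norm // sgnE expr0 => h.
  have n0 : 1 - x != 0 by rewrite subr_eq0 gt_eqF.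
  by apply: (mulfI n0); rewrite mulrBr h divff // subrr mulr0.
apply: derive0_eq0 => [|x Dx|x x0 x1].
- by rewrite Li1_at0 /Lg subr0 ln_1 oppr0 subr0.
- by exists 0; apply: d.
- by apply: d; rewrite /unit_dom (ltW x0).
Qed.

(** The meeting point of the two regularisations: zeta(1) is T in both, because [harm] and
    [Li1 false 1] are the two scales themselves. *)
Lemma asym_Li1 a s : (0 < s)%N -> asym unit_dom Lg (Li1 a s) (zeta_star [:: (s, a)]).
Proof.
move=> s0; have hl : admissible [:: (s, a)] by rewrite /= s0.
have [[-> ->]|ne] := eqVneq (s, a) (1%N, false); last first.
  by rewrite zeta_star_convergent //; apply: Li_asym_zeta.
have -> : zeta_star [:: (1%N, false)] = 'X.
  apply: asymN_unique (zeta_star_asym _) (asym_horner _ _ 'X) _ => //.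
  apply: (is_lim_seq_ext (fun=> (0 : R))); last exact: is_lim_seq_const.
  by move=> n; rewrite hornerX subrr.
apply: eq_asym (asym_horner _ _ 'X) => x Dx.
by rewrite hornerX Li1_1.
Qed.

Definition zeta3 (w : nat) (a b c : bool) : {poly R} :=
  comp3 w (fun s t r => zeta_star [:: (s, a)] * zeta_star [:: (t, b)] * zeta_star [:: (r, c)]).

Definition wsum (w : nat) (a b c : bool) : {poly R} :=
  comp3 w (fun s t r => (3 ^+ s.-1 * 2 ^+ t.-1) *:
    zeta_sh [:: (s, a); (t, a (+) b); (r, b (+) c)]).

Lemma asym_wsum w a b c : asym unit_dom Lg (Li_wsum3 w a b c) (wsum w a b c).
Proof.
apply: asym_comp3 Lg_ge0 _ _ _ _ => s t r s0 t0 r0.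
by apply: asymZ Lg_ge0 _ _ _ _; apply: zeta_sh_asym; rewrite /= s0 t0 r0.
Qed.

Lemma wsum_zeta3 w a b c :
  wsum w.+2 a b c + wsum w.+2 a c b + wsum w.+2 b a c + wsum w.+2 b c a
  + wsum w.+2 c a b + wsum w.+2 c b a = zeta3 w.+2 a b c.
Proof.
have L0 := Lg_ge0.
apply: (@asymI_unique (Li_prod3 w.+2 a b c)).
  have h d e f := asym_wsum w.+2 d e f.
  have := asymD L0 (asymD L0 (asymD L0 (asymD L0 (asymD L0 (h a b c) (h a c b))
    (h b a c)) (h b c a)) (h c a b)) (h c b a).
  by apply: eq_asym => x Dx; rewrite shuffle3.
apply: (asym_comp3 L0) => s t r s0 t0 r0.
by do 2?[apply: (asymM L0)]; apply: asym_Li1.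
Qed.

(** Stored as a list so that the same data can be read on truncated sums and on polynomials. [J] is
    [stuffle3] for a pair of tails; [K] collects one tail weighted by u and one negated [join2]. *)
Definition stuffle_terms (u : nat) (b c d : bool) : seq (R * eindex) :=
  let z := b (+) c (+) d in
  let J e f := [:: (1, [:: (1%N, e); (1%N, f); (u, z)]); (1, [:: (1%N, f); (1%N, e); (u, z)]);
                   (1, [:: (2%N, e (+) f); (u, z)]); (1, [:: (1%N, e); (u.+1, f (+) z)]);
                   (1, [:: (1%N, f); (u.+1, e (+) z)]); (1, [:: (u.+2, e (+) f (+) z)])] in
  let K e := [:: (u%:R, [:: (1%N, e); (u.+1, z)]); (u%:R, [:: (u.+2, e (+) z)]);
                 (-1, [:: (2%N, e); (u, z)]); (-2, [:: (u, z); (2%N, e)]);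
                 (-1, [:: (u.+2, e (+) z)])] in
  J c d ++ J b d ++ J b c ++ K b ++ K c ++ K d ++ [:: ('C(u.+1, 2)%:R, [:: (u.+2, z)])].

Lemma triple_sum_stuffle u b c d M :
  triple_sum u b c d (fun=> M) M = \sum_(p <- stuffle_terms u b c d) p.1 * trunc_zeta p.2 M.
Proof.
rewrite /stuffle_terms !big_cat /= !big_cons !big_nil /=.
rewrite /triple_sum; set z := b (+) c (+) d.
have t1 e : \sum_(1 <= n < M.+1) term u.+1 z n * tail1 e M n =
    trunc_zeta [:: (1%N, e); (u.+1, z)] M + trunc1 u.+2 (e (+) z) M.
  under eq_bigr do rewrite mulrBr.
  rewrite sumrB -mulr_suml -trunc1_sum -trunc_zeta_sum mulrC stuffle2 add1n; ring.
have t2 e : \sum_(1 <= n < M.+1) term u z n * join2 e M n =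
    trunc_zeta [:: (2%N, e); (u, z)] M + 2 * trunc_zeta [:: (u, z); (2%N, e)] M
    + trunc1 u.+2 (e (+) z) M.
  under eq_bigr do rewrite mulrDr.
  rewrite big_split /= -mulr_suml -trunc1_sum -trunc_zeta_sum mulrC stuffle2 add2n; ring.
have -> : \sum_(1 <= n < M.+1)
    (term u z n * (tail1 c M n * tail1 d M n + tail1 b M n * tail1 d M n
                   + tail1 b M n * tail1 c M n)
     + u%:R * term u.+1 z n * (tail1 b M n + tail1 c M n + tail1 d M n)
     - term u z n * (join2 b M n + join2 c M n + join2 d M n)
     + 'C(u.+1, 2)%:R * term u.+2 z n) =
  \sum_(1 <= n < M.+1)
    (term u z n * tail1 c M n * tail1 d M n + term u z n * tail1 b M n * tail1 d M n
     + term u z n * tail1 b M n * tail1 c M n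
     + u%:R * (term u.+1 z n * tail1 b M n) + u%:R * (term u.+1 z n * tail1 c M n)
     + u%:R * (term u.+1 z n * tail1 d M n)
     + (-1) * (term u z n * join2 b M n) + (-1) * (term u z n * join2 c M n)
     + (-1) * (term u z n * join2 d M n) + 'C(u.+1, 2)%:R * term u.+2 z n).
  by apply: eq_bigr => n _; ring.
rewrite !big_split /= -!mulr_sumr !t1 !t2 !stuffle3 -trunc1_sum.
ring.
Qed.

Lemma stuffle_terms_admissible u b c d p : (0 < u)%N ->
  p \in stuffle_terms u b c d -> admissible p.2.
Proof.
move=> u0; suff /allP h : all (fun p : R * eindex => admissible p.2) (stuffle_terms u b c d).
  exact: h.
by rewrite /stuffle_terms !all_cat /= u0.
Qed.

Lemma zeta3_stuffle u b c d : (2 <= u)%N ->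
  zeta3 u.+2 b c d = \sum_(p <- stuffle_terms u b c d) p.1 *: zeta_star p.2.
Proof.
move=> u2.
pose f M := comp3 u.+2 (fun s t r => trunc1 s b M * trunc1 t c M * trunc1 r d M).
have hf : asymN f (zeta3 u.+2 b c d).
  apply: (asym_comp3 harm_ge0_on) => s t r s0 t0 r0.
  by do 2?[apply: (asymM harm_ge0_on)]; apply: zeta_star_asym; rewrite /= ?s0 ?t0 ?r0.
apply: asymN_unique hf (asym_sum harm_ge0_on (f := fun p M => p.1 * trunc_zeta p.2 M) _) _.
  move=> p hp; apply: (asymZ harm_ge0_on); apply: zeta_star_asym.
  by apply: stuffle_terms_admissible hp; apply: ltnW.
apply: is_lim_seq_ext (triple_sum_error b c d u2) => M.
by rewrite /f triple_product triple_sum_stuffle.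
Qed.

Lemma sum_abc_wsum w a b c (Z : eindex -> {poly R}) :
  (forall s t r, (0 < s)%N -> (0 < t)%N -> (0 < r)%N ->
     zeta_sh [:: (s, a); (t, a (+) b); (r, b (+) c)] = Z [:: (s, a); (t, a (+) b); (r, b (+) c)]) ->
  comp3 w (fun s t r => ((3 ^ (s - 1) * 2 ^ (t - 1))%N%:R : R) *:
    Z [:: (s, a); (t, a (+) b); (r, b (+) c)]) = wsum w a b c.
Proof.
move=> h; apply: eq_comp3 => s t r s0 t0 r0.
by rewrite h // !subn1 natrM !natrX.
Qed.

Theorem theorem6p1 (w : nat) (hw : (4 <= w)%N) :
  let u := (w - 2)%N in
  let v := (w - 1)%N in
  let wt (a b : nat) : R := (3 ^ (a - 1) * 2 ^ (b - 1))%N%:R in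
  (* first identity *)
  (2%:R : R) *: sum_abc w (fun a b c => wt a b *: zeta_sh [:: nb a; nb b; nb c])
  = ((3%:R : R)^-1 * 'C(v, 2)%:R + u%:R) *: zetaP [:: nb w]
    + 2%:R *: zeta_star [:: nb 1; nb 1; nb u]
    - 2%:R *: zetaP [:: nb u; nb 2]
    + w%:R *: zeta_star [:: nb 1; nb v]
  /\
  (* second identity *)
  (2%:R : R) *: sum_abc w (fun a b c => wt a b *:
      (zeta_sh [:: nb a; bb b; nb c] + zetaP [:: bb a; nb b; bb c]
       + zetaP [:: bb a; bb b; bb c]))
  = 2%:R *: zetaP [:: bb 1; nb 1; nb u] + 2%:R *: zeta_star [:: nb 1; bb 1; nb u]
    + 2%:R *: zetaP [:: bb 1; bb 1; nb u] + ('C(v, 2)%:R : R) *: zetaP [:: nb w]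
    + 2%:R *: zetaP [:: bb 1; nb v]
    + 2%:R *: zeta_star [:: nb 1; bb v] + 2%:R *: zetaP [:: bb 1; bb v]
    - 2%:R *: zetaP [:: nb u; nb 2] - 4%:R *: zetaP [:: nb u; bb 2]
    + (u%:R : R) *: (2%:R *: zetaP [:: bb 1; nb v] + 2%:R *: zetaP [:: bb w]
                     + zetaP [:: nb w] + zeta_star [:: nb 1; nb v])
  /\
  (* third identity *)
  (2%:R : R) *: sum_abc w (fun a b c => wt a b *:
      (zeta_sh [:: nb a; bb b; bb c] + zeta_sh [:: nb a; nb b; bb c]
       + zetaP [:: bb a; bb b; nb c]))
  = 2%:R *: zeta_star [:: nb 1; nb 1; bb u] + 2%:R *: zeta_star [:: nb 1; bb 1; bb u]
    + 2%:R *: zetaP [:: bb 1; nb 1; bb u] + 2%:R *: zeta_star [:: nb 1; bb v]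
    + 2%:R *: zetaP [:: bb 1; bb v]
    + 2%:R *: zeta_star [:: nb 1; nb v] + zetaP [:: bb 2; bb u] - zetaP [:: nb 2; bb u]
    - 4%:R *: zetaP [:: bb u; nb 2] - 2%:R *: zetaP [:: bb u; bb 2]
    + (u%:R : R) *: (2%:R *: zeta_star [:: nb 1; bb v] + zetaP [:: bb 1; bb v]
                     + zetaP [:: nb w] + 2%:R *: zetaP [:: bb w])
    + ('C(v, 2)%:R : R) *: zetaP [:: bb w] + zetaP [:: nb w] - zetaP [:: bb w]
  /\
  (* fourth identity *)
  (2%:R : R) *: sum_abc w (fun a b c => wt a b *: zetaP [:: bb a; nb b; nb c])
  = 2%:R *: zetaP [:: bb 1; bb 1; bb u] + (u%:R : R) *: zetaP [:: bb 1; bb v]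
    + 2%:R *: zetaP [:: bb 1; nb v] + zetaP [:: nb 2; bb u]
    - 2%:R *: zetaP [:: bb u; bb 2] - zetaP [:: bb 2; bb u]
    + ((3%:R : R)^-1 * 'C(v, 2)%:R + 1) *: zetaP [:: bb w]
    + ((w - 3)%N%:R : R) *: zetaP [:: nb w].
Proof.
case: w hw => [|[|[|[|k]]]] // _; cbv zeta.
have -> : (k.+4 - 2 = k.+2)%N by lia.
have -> : (k.+4 - 1 = k.+3)%N by lia.
have -> : (k.+4 - 3 = k.+1)%N by lia.
have w1 a b c s t r : (0 < s)%N -> (0 < t)%N -> (0 < r)%N ->
  convergent [:: (s, a); (t, a (+) b); (r, b (+) c)] ->
  zeta_sh [:: (s, a); (t, a (+) b); (r, b (+) c)] = zetaP [:: (s, a); (t, a (+) b); (r, b (+) c)].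
  by move=> s0 t0 r0; apply: zeta_sh_convergent; rewrite /= s0 t0 r0.
have shE a b c : comp3 k.+4 (fun s t r => ((3 ^ (s - 1) * 2 ^ (t - 1))%N%:R : R) *:
    zeta_sh [:: (s, a); (t, a (+) b); (r, b (+) c)]) = wsum k.+4 a b c.
  exact: sum_abc_wsum.
(* A first letter -1 makes the index convergent, so the regularised value is the ordinary one. *)
have zE b c : comp3 k.+4 (fun s t r => ((3 ^ (s - 1) * 2 ^ (t - 1))%N%:R : R) *:
    zetaP [:: (s, true); (t, true (+) b); (r, b (+) c)]) = wsum k.+4 true b c.
  by apply: sum_abc_wsum => s t r s0 t0 r0; apply: w1 => //; rewrite /= xpair_eqE andbF.
have -> : sum_abc k.+4 (fun a b c => (3 ^ (a - 1) * 2 ^ (b - 1))%N%:R *: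
    zeta_sh [:: nb a; nb b; nb c]) = wsum k.+4 false false false.
  by rewrite sum_abcE; apply: (shE false false false).
(* Letters are successive products of signs: the three indices have letters (1,-1,-1), (-1,-1,1) and
   (-1,1,-1), all orderings of one multiset. *)
have -> : sum_abc k.+4 (fun a b c => (3 ^ (a - 1) * 2 ^ (b - 1))%N%:R *:
    (zeta_sh [:: nb a; bb b; nb c] + zetaP [:: bb a; nb b; bb c]
     + zetaP [:: bb a; bb b; bb c])) =
  wsum k.+4 false true true + wsum k.+4 true true false + wsum k.+4 true false true.
  rewrite sum_abcE -(shE false true true) -(zE true false) -(zE false true) -!comp3D.
  by apply: eq_comp3 => s t r _ _ _; rewrite !scalerDr.
have -> : sum_abc k.+4 (fun a b c => (3 ^ (a - 1) * 2 ^ (b - 1))%N%:R *: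
    (zeta_sh [:: nb a; bb b; bb c] + zeta_sh [:: nb a; nb b; bb c]
     + zetaP [:: bb a; bb b; nb c])) =
  wsum k.+4 false true false + wsum k.+4 false false true + wsum k.+4 true false false.
  rewrite sum_abcE -(shE false true false) -(shE false false true) -(zE false false) -!comp3D.
  by apply: eq_comp3 => s t r _ _ _; rewrite !scalerDr.
have -> : sum_abc k.+4 (fun a b c => (3 ^ (a - 1) * 2 ^ (b - 1))%N%:R *:
    zetaP [:: bb a; nb b; nb c]) = wsum k.+4 true true true.
  by rewrite sum_abcE; apply: (zE true true).
(* Ordinary values become star values, so that both sides are combinations of the same polynomials;
   below, [n1] and [n4] express the coefficients through u. *)
rewrite /nb /bb -!zeta_star_convergent //.
have key b c d := wsum_zeta3 k.+2 b c d.
have {}key b c d := etrans (key b c d) (@zeta3_stuffle k.+2 b c d isT).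
have n1 : k.+1%:R = k.+2%:R - 1 :> R by rewrite -[k.+2]addn1 natrD addrK.
have n4 : k.+4%:R = k.+2%:R + 2 :> R by rewrite -[k.+4]addn2 natrD.
rewrite n1 n4; move: key.
rewrite /stuffle_terms; move: ('C(k.+3, 2)%:R : R) (k.+2%:R : R) => C U key.
(* Each identity is now linear in the coefficients. In [wsum_zeta3] a letter occurring exactly twice
   makes every sum appear twice, and three equal letters give a factor 6, hence the 1/3. *)
split; [|split; [|split]]; apply/polyP => i.
- have := congr1 (fun p : {poly R} => p`_i) (key false false false).
  rewrite !big_cat /= !big_cons !big_nil /= !(coefD, coefN, coefZ, coef0).
  lra.
- have := congr1 (fun p : {poly R} => p`_i) (key false true true).
  rewrite !big_cat /= !big_cons !big_nil /= !(coefD, coefN, coefZ, coef0).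
  lra.
- have := congr1 (fun p : {poly R} => p`_i) (key false false true).
  rewrite !big_cat /= !big_cons !big_nil /= !(coefD, coefN, coefZ, coef0).
  lra.
- have := congr1 (fun p : {poly R} => p`_i) (key true true true).
  rewrite !big_cat /= !big_cons !big_nil /= !(coefD, coefN, coefZ, coef0).
  lra.
Qed.
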